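(* Let $(X,d)$, $G$, $o$ be as in the context, let $(\omega_n)_n$ be the random walk generated by a non-elementary probability measure $\mu$ on $G$, and let $\lambda(\mu)\in(0,+\infty]$ be the almost sure limit of $d(o,\omega_n o)/n$. Then for every $0<L<\lambda(\mu)$ there exists $K>0$ such that for all $n$, \[ \mathbb P\big[d(o,\omega_n o)\le Ln\big]\le K e^{-n/K}. \]
   Context: $(X,d)$ is a geodesic metric space, $G$ is a countable group of isometries of $X$ containing two independent contracting isometries, and $o\in X$ a basepoint. For $A\subseteq X$, $\pi_A(x)=\{a\in A: d(x,a)=d(x,A)\}$; $A$ is $K$-contracting if $\pi_A(z)\ne\emptyset$ for all $z$ and $d(x,y)\le d(x,A)-K$ implies $\operatorname{diam}(\pi_A(x)\cup\pi_A(y))\le K$. A $K$-quasigeodesic is a map $\gamma$ from a set of consecutive integers (or an interval) to $X$ with $|s-t|/K-K\le d(\gamma(s),\gamma(t))\le K|s-t|+K$. An isometry $g$ is contracting if $n\in\mathbb Z\mapsto g^no$ is a $K$-quasigeodesic with $K$-contracting image for some $K$. $g,h$ are independent if $\{(n,m):d(g^no,h^mo)<M\}$ is bounded for each $M>0$. $\mu$ is non-elementary if the semigroup generated by $\operatorname{supp}\mu$ contains two independent contracting isometries. $\omega_n=g_1\cdots g_n$ with $(g_i)$ i.i.d. of law $\mu$; the limit $\lambda(\mu)=\lim_n d(o,\omega_no)/n$ exists almost surely and is a constant in $(0,+\infty]$. *)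

(* Defs.v *)
From HB Require Import structures.
From mathcomp Require Import all_boot all_order all_algebra.
From mathcomp Require Import all_classical all_reals all_analysis.
Set Implicit Arguments. Unset Strict Implicit. Unset Printing Implicit Defensive.
Import Order.TTheory GRing.Theory Num.Theory.
Local Open Scope classical_set_scope.
Local Open Scope ring_scope.

Section Geometry.
Variables (R : realType) (X : Type) (d : X -> X -> R).

Definition is_metric : Prop :=
  (forall x y, 0 <= d x y) /\ (forall x y, d x y = 0 <-> x = y) /\
  (forall x y, d x y = d y x) /\ (forall x y z, d x z <= d x y + d y z).

Definition is_geodesic_space : Prop :=
  forall x y, exists gam : R -> X, gam 0 = x /\ gam (d x y) = y /\
    forall s t, 0 <= s <= d x y -> 0 <= t <= d x y ->
      d (gam s) (gam t) = `|s - t|.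

Definition dist_set (x : X) (A : set X) : R := inf [set d x a | a in A].

Definition proj (A : set X) (x : X) : set X :=
  [set a | A a /\ d x a = dist_set x A].

Definition contracting_set (K : R) (A : set X) : Prop :=
  (forall z, proj A z !=set0) /\
  (forall x y, d x y <= dist_set x A - K ->
     forall a b, (proj A x `|` proj A y) a -> (proj A x `|` proj A y) b ->
       d a b <= K).

Definition quasigeodesic (K : R) (gam : int -> X) : Prop :=
  forall s t : int,
    `|(s - t)%:~R : R| / K - K <= d (gam s) (gam t) /\
    d (gam s) (gam t) <= K * `|(s - t)%:~R : R| + K.

End Geometry.

Section Group.
Variables (G : Type) (mul : G -> G -> G) (inv : G -> G) (one : G).

Definition gpowz (g : G) (n : int) : G :=
  match n with
  | Posz k => iter k (mul g) one
  | Negz k => iter k.+1 (mul (inv g)) one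
  end.

Variables (R : realType) (X : Type) (d : X -> X -> R) (act : G -> X -> X) (o : X).

Definition isometry_group : Prop :=
  (forall a b c, mul a (mul b c) = mul (mul a b) c) /\
  (forall a, mul one a = a) /\ (forall a, mul a one = a) /\
  (forall a, mul (inv a) a = one) /\ (forall a, mul a (inv a) = one) /\
  (forall x, act one x = x) /\
  (forall a b x, act (mul a b) x = act a (act b x)) /\
  (forall a x y, d (act a x) (act a y) = d x y) /\
  (forall a b, (forall x, act a x = act b x) -> a = b).

Definition contracting_isometry (g : G) : Prop :=
  exists K : R, 0 < K /\
    quasigeodesic d K (fun n => act (gpowz g n) o) /\
    contracting_set d K (range (fun n => act (gpowz g n) o)).

Definition independent (g h : G) : Prop :=
  forall M : R, 0 < M -> exists N : nat, forall n m : int,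
    d (act (gpowz g n) o) (act (gpowz h m) o) < M ->
    (`|n| <= N)%N /\ (`|m| <= N)%N.

Definition in_semigroup (S : set G) (g : G) : Prop :=
  exists (x0 : G) (s : seq G), S x0 /\ (forall k, (k < size s)%N -> S (nth x0 s k)) /\
    g = foldl mul x0 s.

End Group.

Section Walk.
Local Open Scope ereal_scope.
Variables (R : realType) (G : choiceType).

(* mu given by its weights p on the countable group G *)
Definition mass (p : G -> R) (A : set G) : \bar R := \esum_(h in A) (p h)%:E.

Definition is_prob_weights (p : G -> R) : Prop :=
  (forall g, (0 <= p g)%R) /\ mass p setT = 1.

Definition supp (p : G -> R) : set G := [set g | (0 < p g)%R].

Variables (dT : measure_display) (T : measurableType dT) (P : probability T R).

(* (g_i)_{i : nat} are i.i.d. random variables of law mu (discrete sigma-algebra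
   on G): every preimage is measurable, and for all n and all A_0..A_{n-1},
   P(g_0 in A_0, ..., g_{n-1} in A_{n-1}) = mu(A_0) ... mu(A_{n-1}). *)
Definition iid_law (p : G -> R) (gs : nat -> T -> G) : Prop :=
  (forall i (A : set G), measurable (gs i @^-1` A)) /\
  (forall (n : nat) (A : nat -> set G),
     P (\bigcap_(i in `I_n) (gs i @^-1` A i)) =
     \big[*%E/1%E]_(i < n) mass p (A i)).

(* omega_n = g_1 ... g_n (here indexed gs 0, ..., gs (n-1)) *)
Fixpoint walk (mul : G -> G -> G) (one : G) (gs : nat -> T -> G) (n : nat) (w : T) : G :=
  match n with
  | 0 => one
  | k.+1 => mul (walk mul one gs k w) (gs k w)
  end.
End Walk.

(* Main.v *)
Require Import Defs.
From HB Require Import structures.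
From mathcomp Require Import all_boot all_order all_algebra.
From mathcomp Require Import all_classical all_reals all_analysis.
From mathcomp Require Import ring lra zify.
Set Implicit Arguments. Unset Strict Implicit. Unset Printing Implicit Defensive.
Import Order.TTheory GRing.Theory Num.Theory.
Local Open Scope classical_set_scope.
Local Open Scope ring_scope.

(** Pivoting, after Gouezel.  From powers of two independent contracting elements one builds
    [s_1 .. s_k], words of the same length in the support, such that for every [w] at most one
    [s_i] backtracks against [w] on a given side.  In a random word [w_0 s w_1 s .. w_r], with
    each [s] uniform in the family, keep a stack of slots whose index is still random, all
    consecutive pieces being aligned, so that the lengths of the pieces add up.  A new long
    [w_i] creates a slot, except with probability [O(1/k)], in which case at most one slot is
    dissolved; hence the number of slots is at least [(1 - O(1/k)) r] outside an event of
    exponentially small probability.  The walk is written in this form, the [w_i] being mostly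
    blocks of [N] steps, whose displacement exceeds [L' N] (with [L < L' < lam]) with
    probability close to [1]. *)

(** The number of slots is never estimated as a random variable. What is bounded is the mean of
    [decay], the exponential of minus the length measured in units of [B - E], the least gain of a
    slot. With r slots it is at most a constant times e^-r; creating a slot multiplies the bound by
    e^-1, dissolving one multiplies it by e but has weight 1/k, and Markov's inequality concludes.
    The steps have no moments, so lengths are only bounded from below: a short or misaligned piece
    costs a constant factor, however long it is. Letters of the family are not read off the walk
    either: the m-th convolution power of the law merely dominates [alpha] times the uniform law on
    the family, and what remains is a positive operator of mass [1 - alpha] about which nothing else
    is known. The order of choices matters: k depends on L and L' only; the family then fixes E, m
    and [alpha]; then come J and finally N, so large that E and the waiting time m J are negligible
    compared with N. *)

Local Notation proj := Defs.proj.

(** * Contracting sets *)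

Section StrongContraction.
Variables (R : realType) (X : Type) (d : X -> X -> R).
Hypothesis dm : is_metric d.

Let d_ge0 x y : 0 <= d x y. Proof. by case: dm. Qed.
Let dC x y : d x y = d y x. Proof. by case: dm => _ [_ []]. Qed.
Let d_tri x y z : d x z <= d x y + d y z. Proof. by case: dm => _ [_ [_]]. Qed.
Let dxx x : d x x = 0. Proof. by case: dm => _ [] /(_ x x)[_ ->]. Qed.

Lemma dist_set_le (A : set X) (x a : X) : A a -> dist_set d x A <= d x a.
Proof.
move=> Aa; apply: ge_inf; last by exists a.
by exists 0 => _ [b _ <-].
Qed.

(** Contraction restated without geodesics: when two projections are far apart, the detour through
    them is optimal up to [kap]. The Schottky construction uses contraction in this form. *)
Definition strongly_contracting (kap : R) (A : set X) : Prop :=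
  (forall x, proj d A x !=set0) /\
  (forall x y a b, proj d A x a -> proj d A y b -> kap < d a b ->
     d x a + d a b + d b y <= d x y + kap).

Hypothesis geo : is_geodesic_space d.

Lemma geodesic_point (x y : X) (r : R) : 0 <= r <= d x y ->
  exists z, d x z = r /\ d z y = d x y - r.
Proof.
move=> /andP[r0 rd]; have [gam [g0 [g1 giso]]] := geo x y.
have h0 : 0 <= (0 : R) <= d x y by rewrite lexx d_ge0.
have hr : 0 <= r <= d x y by rewrite r0.
have h1 : 0 <= d x y <= d x y by rewrite lexx d_ge0.
exists (gam r); have e1 := giso _ _ h0 hr; have e2 := giso _ _ hr h1.
move: e1 e2; rewrite g0 g1 => -> ->; split; first by rewrite sub0r normrN ger0_norm.
by rewrite distrC ger0_norm // subr_ge0.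
Qed.

Variables (K : R) (A : set X).
Hypotheses (K0 : 0 < K) (Ac : contracting_set d K A).

Let pjE x : proj d A x !=set0. Proof. by case: Ac. Qed.

Let pj_near x y p q : d x y <= dist_set d x A - K -> proj d A x p ->
  proj d A y q -> d p q <= K.
Proof. by move=> h hp hq; case: Ac => _ /(_ x y h p q); apply; [left|right]. Qed.

Let pj_diam x p q : proj d A x p -> proj d A x q -> d p q <= 2 * K.
Proof.
move=> hp hq; have [h|h] := lerP K (dist_set d x A).
  have := @pj_near x x p q; rewrite dxx subr_ge0 => /(_ h hp hq).
  by move: K0; lra.
have := d_tri p x q; rewrite (dC p x).
by case: hp => _ ->; case: hq => _ ->; lra.
Qed.

(* Follow a geodesic from [x] to [y] by steps of length [d(z, A) - K]: each step
   moves the projection by at most [K], and has length at least [2K] until the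
   [3K]-neighbourhood of [A] is reached. *)
Lemma contracting_walk (n : nat) (x y : X) : d x y <= 2 * K * n%:R ->
  exists (z : X) (m : nat), d x z + d z y = d x y /\
    (dist_set d z A <= 3 * K \/ z = y) /\
    (forall p q, proj d A x p -> proj d A z q -> d p q <= m%:R * K) /\
    2 * K * (m%:R - 2) <= d x z.
Proof.
elim: n x => [|n IH] x hxy.
  have xy : x = y.
    by case: dm => _ [] /(_ x y)[h _] _; apply: h; apply/eqP; rewrite eq_le d_ge0;
       move: hxy; rewrite mulr0 => ->.
  (* The counter starts at 2 because two projections of the same point may be [2 * K] apart. *)
  exists x, 2; rewrite dxx add0r; split=> //; split; first by right.
  by split; [exact: pj_diam | rewrite subrr mulr0].
have [h3|h3] := lerP (dist_set d x A) (3 * K).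
  exists x, 2; rewrite dxx add0r; split=> //; split; first by left.
  by split; [exact: pj_diam | rewrite subrr mulr0].
set r := dist_set d x A - K; have [hr|hr] := lerP (d x y) r.
  exists y, 2; rewrite dxx addr0; split=> //; split; first by right.
  split; last by rewrite subrr mulr0.
  move=> p q hp hq; have := pj_near hr hp hq; move: K0.
  by lra.
have [|x1 [e1 e2]] := @geodesic_point x y r.
  by rewrite (ltW hr) andbT /r; move: K0; lra.
have [|z [m [b [hz [hp hm]]]]] := IH x1.
  rewrite e2; move: hxy; rewrite -natr1 /r; move: K0 h3; lra.
have b' : d x z = r + d x1 z.
  have h1 := d_tri x x1 z; have h2 := d_tri x z y; apply/eqP; rewrite eq_le.
  by apply/andP; split; lra.
exists z, m.+1; split; first by lra.
split=> //; split.
  move=> p q hxp hzq; have [p1 hp1] := pjE x1.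
  have := pj_near _ hxp hp1; rewrite e1 => /(_ (lexx _)) h1.
  by have := hp _ _ hp1 hzq; have := d_tri p p1 q; rewrite -natr1 mulrDl mul1r; lra.
by rewrite b' -natr1 /r; move: K0 h3 hm; lra.
Qed.

(** Up to a constant, the projection moves at most half as fast as the walking point. A walk whose
    projection goes from near [a] to near [b] without approaching [A] would thus be longer than the
    triangle inequality through [a] and [b] allows. *)
Lemma contracting_near (x y a b : X) : proj d A x a -> proj d A y b ->
  12 * K < d a b -> exists z, d x z + d z y = d x y /\ d z a <= 13 * K.
Proof.
move=> ha hb dab; have ea := ha.2; have eb := hb.2.
have [h3|h3] := lerP (dist_set d x A) (3 * K).
  by exists x; rewrite dxx add0r; split=> //; move: K0; lra.
have [hr|hr] := lerP (d x y) (dist_set d x A - K).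
  by have := pj_near hr ha hb; move: K0; lra.
have [y1 [r' [e1 [e2 [hy1 [r'0 hr']]]]]] : exists y1 r', d x y1 = d x y - r' /\ d y1 y = r' /\
    (forall q, proj d A y1 q -> d q b <= 2 * K) /\ 0 <= r' /\ dist_set d y A - K <= r'.
  have [h|h] := lerP (dist_set d y A) K.
    exists y, 0; rewrite dxx subr0; split=> //; split=> //; split; last by split=> //; lra.
    by move=> q hq; apply: pj_diam hb.
  have [hr'|hr'] := lerP (d x y) (dist_set d y A - K).
    by move: hr'; rewrite dC => /pj_near/(_ hb ha); rewrite dC; move: K0; lra.
  have [|y1 [f1 f2]] := @geodesic_point y x (dist_set d y A - K).
    by rewrite dC (ltW hr') andbT; lra.
  exists y1, (dist_set d y A - K); rewrite dC f2 (dC y x) (dC y1 y) f1.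
  split=> //; split=> //; split; last by split=> //; lra.
  move=> q hq; have := pj_near _ hb hq; rewrite f1 => /(_ (lexx _)).
  by rewrite dC; move: K0; lra.
have [q1 hq1] := pjE y1; have hq1b := hy1 _ hq1.
have [hxy1|hxy1] := lerP (d x y1) (dist_set d x A - K).
  by have := pj_near hxy1 ha hq1; have := d_tri a q1 b; move: K0; lra.
have [|x1 [f1 f2]] := @geodesic_point x y1 (dist_set d x A - K).
  by rewrite (ltW hxy1) andbT; move: K0; lra.
have K20 : 0 < 2 * K by move: K0; lra.
have [n hn] : exists n : nat, d x1 y1 <= 2 * K * n%:R.
  exists (Num.bound (d x1 y1 / (2 * K))).
  have : 0 <= d x1 y1 / (2 * K) by apply: divr_ge0 => //; exact: ltW.
  move=> /archi_boundP/ltW; rewrite ler_pdivrMr // mulrC.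
  by move=> ->.
have [z [m [bt [hz [hp hm]]]]] := contracting_walk hn.
have [p1 hp1] := pjE x1.
have hap1 : d a p1 <= K by apply: (pj_near _ ha hp1); rewrite f1.
(* Both cases below satisfy this with c = 5, so m <= 9. Then 3K + 9K + K = 13K bounds [d z a] in the
   first case, and K + 9K + 2K = 12K contradicts the distance from [a] to [b] in the second. *)
have m9 (c : R) : 2 * K * (m%:R - 2) <= m%:R * K + c * K -> m%:R <= 4 + c.
  by move=> h; rewrite -(ler_pM2r K0); move: h; lra.
have [pz hpz] := pjE z; have hmz := hp _ _ hp1 hpz.
have t1 := d_tri a p1 pz.
case: hz => hz.
  have ezz := hpz.2.
  have bx : d x z = dist_set d x A - K + d x1 z.
    have h1 := d_tri x x1 z; have h2 := d_tri x z y1; apply/eqP; rewrite eq_le.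
    by apply/andP; split; lra.
  have by_ : d z y = d z y1 + r'.
    have h1 := d_tri z y1 y; have h2 := d_tri x z y; apply/eqP; rewrite eq_le.
    by apply/andP; split; lra.
  exists z; split; first by lra.
  have t2 := d_tri x a z; have t3 := d_tri a pz z; rewrite (dC pz z) in t3.
  have := m9 5%:R; rewrite (dC z a) => /(_ _) h9.
  have {h9} : m%:R <= 4 + 5%:R :> R by apply: h9; lra.
  by rewrite -(ler_pM2r K0); lra.
have {}hmz : d p1 q1 <= m%:R * K by apply: hp => //; rewrite hz.
have t2 := d_tri a p1 b; have t3 := d_tri p1 q1 b.
have t4 := d_tri x a y; have t5 := d_tri a b y; rewrite (dC b y) in t5.
have : m%:R <= 4 + 5%:R :> R by apply: m9; rewrite hz in hm; lra.
by rewrite -(ler_pM2r K0); lra.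
Qed.

(** Insert [a] between x and y, then [b] between y and [a], the point [a] being its own projection.
    Each insertion costs twice 13K. *)
Lemma contracting_strongly : strongly_contracting (52 * K) A.
Proof.
split=> // x y a b ha hb hab.
have hab' : 12 * K < d a b by move: K0; lra.
have haa : proj d A a a.
  split; first by case: ha.
  apply/eqP; rewrite eq_le; apply/andP; split; last by apply: dist_set_le; case: ha.
  by have [q hq] := pjE a; rewrite -hq.2 dxx.
have [z [e1 h1]] := contracting_near ha hb hab'.
have [|z' [e2 h2]] := contracting_near hb haa; first by rewrite dC.
have := d_tri x z a; have := d_tri a z y; have := d_tri y z' b; have := d_tri b z' a.
rewrite (dC a z) (dC b z') (dC b a) (dC b y) (dC a y) in e2 *.
move: e1 e2 h1 h2; rewrite (dC y a) (dC z' a); lra.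
Qed.

End StrongContraction.

(** * Schottky families *)

Section WordProduct.
Variables (G : Type) (mul : G -> G -> G) (one : G).
Hypotheses (mulA : forall a b c, mul a (mul b c) = mul (mul a b) c)
  (mul1g : forall a, mul one a = a) (mulg1 : forall a, mul a one = a).

Definition word_prod (l : seq G) : G := foldr mul one l.

Lemma word_prod_cat l1 l2 :
  word_prod (l1 ++ l2) = mul (word_prod l1) (word_prod l2).
Proof. by elim: l1 => [|x l IH] /=; rewrite ?mul1g // IH mulA. Qed.

Definition is_word (S : set G) (m : nat) (x : G) : Prop :=
  exists l : seq G, size l = m /\ List.Forall S l /\ x = word_prod l.

Lemma is_word_mul S m1 m2 x1 x2 : is_word S m1 x1 -> is_word S m2 x2 ->
  is_word S (m1 + m2) (mul x1 x2).
Proof.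
move=> [l1 [<- [h1 ->]]] [l2 [<- [h2 ->]]]; exists (l1 ++ l2).
by rewrite size_cat word_prod_cat; split=> //; split=> //; apply/List.Forall_app.
Qed.

Lemma is_word_pow S m x n : is_word S m x -> is_word S (n * m) (iter n (mul x) one).
Proof.
move=> hx; elim: n => [|n IH] /=; first by exists [::].
by rewrite mulSn; apply: is_word_mul.
Qed.

Lemma semigroup_word S x : in_semigroup mul S x ->
  exists m, is_word S m.+1 x.
Proof.
move=> [x0 [s [Sx0 [hs ->]]]].
have foldE : forall s y, foldl mul y s = mul y (word_prod s).
  by elim=> [|z t IH] y /=; rewrite ?mulg1 // IH -mulA.
exists (size s), (x0 :: s); split=> //; split; last by rewrite foldE.
apply: List.Forall_cons => //.
elim: s hs => [|y t IH] hs //; apply: List.Forall_cons; first exact: (hs 0%N).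
by apply: IH => k hk; apply: (hs k.+1).
Qed.

End WordProduct.

Section Schottky.
Variables (R : realType) (X : Type) (d : X -> X -> R).
Variables (G : Type) (mul : G -> G -> G) (inv : G -> G) (one : G).
Variables (act : G -> X -> X) (o : X).
Hypotheses (dm : is_metric d) (ig : isometry_group mul inv one d act).

Let d_ge0 x y : 0 <= d x y. Proof. by case: dm. Qed.
Let dC x y : d x y = d y x. Proof. by case: dm => _ [_ []]. Qed.
Let d_tri x y z : d x z <= d x y + d y z. Proof. by case: dm => _ [_ [_]]. Qed.
Let dxx x : d x x = 0. Proof. by case: dm => _ [] /(_ x x)[_ ->]. Qed.

Let mulA a b c : mul a (mul b c) = mul (mul a b) c.
Proof. by have [+ _] := ig. Qed.
Let mul1 a : mul one a = a. Proof. by have [_ [+ _]] := ig. Qed.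
Let mulr1 a : mul a one = a. Proof. by have [_ [_ [+ _]]] := ig. Qed.
Let mulVg a : mul (inv a) a = one. Proof. by have [_ [_ [_ [+ _]]]] := ig. Qed.
Let mulgV a : mul a (inv a) = one. Proof. by have [_ [_ [_ [_ [+ _]]]]] := ig. Qed.
Let act1 x : act one x = x. Proof. by have [_ [_ [_ [_ [_ [+ _]]]]]] := ig. Qed.
Let actM a b x : act (mul a b) x = act a (act b x).
Proof. by have [_ [_ [_ [_ [_ [_ [+ _]]]]]]] := ig. Qed.
Let actd a x y : d (act a x) (act a y) = d x y.
Proof. by have [_ [_ [_ [_ [_ [_ [_ [+ _]]]]]]]] := ig. Qed.

Let invP a b : mul a b = one -> b = inv a.
Proof. by move=> h; rewrite -(mul1 b) -(mulVg a) -mulA h mulr1. Qed.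
Let invM a b : inv (mul a b) = mul (inv b) (inv a).
Proof. by symmetry; apply: invP; rewrite mulA -(mulA a) mulgV mulr1 mulgV. Qed.
Let actK a x : act (inv a) (act a x) = x.
Proof. by rewrite -actM mulVg act1. Qed.
Let actVK a x : act a (act (inv a) x) = x.
Proof. by rewrite -actM mulgV act1. Qed.
Let dV a x y : d (act (inv a) x) y = d x (act a y).
Proof. by rewrite -(actd a) actVK. Qed.

Local Notation pw := (gpowz mul inv one).

Lemma gpowz_succ g (n : int) : pw g (n + 1) = mul g (pw g n).
Proof.
case: n => [n|[|n]]; first by rewrite -PoszD addn1.
  by rewrite /= mulr1 mulgV.
have -> : Negz n.+1 + 1 = Negz n by rewrite !NegzE -addn1 PoszD; ring.
by rewrite /= mulA mulgV mul1.
Qed.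

Arguments gpowz : simpl never.

Lemma gpowzD g (m n : int) : pw g (m + n) = mul (pw g m) (pw g n).
Proof.
elim/int_rect: m => [|m IH|m IH]; first by rewrite add0r (mul1 (pw g n)).
  by rewrite -addn1 PoszD addrAC gpowz_succ IH gpowz_succ mulA.
have e (z : int) : pw g z = mul (inv g) (pw g (z + 1)).
  by rewrite gpowz_succ mulA mulVg mul1.
rewrite (e (- m.+1%:Z + n)) (e (- m.+1%:Z)) -mulA; congr mul.
have -> : - m.+1%:Z + n + 1 = - m%:Z + n by rewrite -addn1 PoszD; ring.
by rewrite IH; congr (mul (pw g _) _); rewrite -addn1 PoszD; ring.
Qed.

Lemma gpowzN g (n : int) : pw g (- n) = inv (pw g n).
Proof. by apply: invP; rewrite -gpowzD subrr. Qed.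

Lemma dist_set_act (A : set X) g x : (forall y, A y <-> A (act g y)) ->
  dist_set d (act g x) A = dist_set d x A.
Proof.
move=> gA; congr (inf _); apply/seteqP; split=> _ [a Aa <-].
  exists (act (inv g) a); first by apply/gA; rewrite actVK.
  by rewrite dC dV dC.
by exists (act g a); rewrite ?actd //; apply/(gA a).
Qed.

Lemma proj_act (A : set X) g x a : (forall y, A y <-> A (act g y)) ->
  proj d A (act g x) (act g a) <-> proj d A x a.
Proof. by move=> gA; rewrite /Defs.proj /= dist_set_act // actd -gA. Qed.

Definition axis g : set X := range (fun n : int => act (pw g n) o).

Lemma axis_act g n y : axis g y <-> axis g (act (pw g n) y).
Proof.
split=> [[k _ <-]|[k _ e]].
  by exists (n + k) => //; rewrite gpowzD actM.
by exists (- n + k) => //; rewrite gpowzD actM e gpowzN actK.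
Qed.

Lemma axis_base g : axis g o.
Proof. by exists 0 => //; rewrite /gpowz /= act1. Qed.

Lemma proj_le (A : set X) x p y : proj d A x p -> A y -> d x p <= d x y.
Proof. by move=> [_ ->]; apply: dist_set_le. Qed.

Lemma proj_self (A : set X) x : A x -> proj d A x x.
Proof.
move=> Ax; split=> //; rewrite dxx; apply/eqP; rewrite eq_le; apply/andP; split.
  by apply: lb_le_inf; [exists (d x x), x | move=> _ [y _ <-]].
by rewrite -(dxx x); apply: dist_set_le.
Qed.

(** * Axes of two independent contracting elements *)

Section Axes.
Variables (g h : G) (kap : R).
Hypotheses (kap0 : 0 <= kap)
  (Ac : strongly_contracting d kap (axis g)) (Bc : strongly_contracting d kap (axis h)).

(** If [b] is far from o, the path from [a] through [b] to o is almost geodesic with both ends on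
    the axis of [g], which forces [b] close to that axis. Independence leaves finitely many such
    points on the axis of [h]. *)
Lemma axis_proj_bounded : independent mul inv one d act o g h ->
  exists D : R, 0 <= D /\ forall a b, axis g a -> proj d (axis h) a b -> d o b <= D.
Proof.
move=> ind; have [|N hN] := ind (3 * kap + 1); first by move: kap0; lra.
pose D1 := \sum_(i < N.+1) (d o (act (pw h i%:Z) o) + d o (act (pw h (- i%:Z)) o)).
have D10 : 0 <= D1 by apply: sumr_ge0 => i _; apply: addr_ge0.
have hD1 (m : int) : (`|m| <= N)%N -> d o (act (pw h m) o) <= D1.
  move=> hm; have hm' : (`|m| < N.+1)%N by [].
  rewrite /D1 (bigD1 (Ordinal hm')) //= -[leLHS]addr0; apply: lerD; last first.
    by apply: sumr_ge0 => i _; apply: addr_ge0.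
  have [m0|m0] := lerP 0 m.
    by rewrite (gez0_abs m0) lerDl.
  by rewrite (ltz0_abs m0) opprK lerDr.
exists (D1 + 3 * kap); split; first by move: D10 kap0; lra.
move=> a b ha hb; have [hab|hab] := lerP (d o b) kap.
  by move: D10 kap0; lra.
have hoo := proj_self (axis_base h).
have hbo : d a b + d b o + d o o <= d a o + kap.
  by apply: Bc.2 hb hoo _; rewrite dC.
rewrite dxx in hbo.
have [c hc] := Ac.1 b.
have hbc : d b c <= 3 * kap.
  have h1 : kap < d c o -> d b c + d c o + d o o <= d b o + kap.
    by apply: Ac.2 => //; apply: proj_self; apply: axis_base.
  have h2 : kap < d c a -> d b c + d c a + d a a <= d b a + kap.
    by apply: Ac.2 => //; apply: proj_self.
  rewrite !dxx addr0 in h1 h2.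
  have t1 := d_tri a c o; have t2 := d_tri b o c; have t3 := d_tri b a c.
  have g1 := d_ge0 b o; have g2 := d_ge0 a b.
  rewrite (dC a c) in t1 t3; rewrite (dC o c) in t2; rewrite (dC b a) in h2 t3.
  have [k1|k1] := lerP (d c o) kap; have [k2|k2] := lerP (d c a) kap.
  - by move: kap0; lra.
  - by have := h2 k2; move: kap0; lra.
  - by have := h1 k1; move: kap0; lra.
  - by have := h1 k1; have := h2 k2; move: kap0; lra.
have [m _ em] := hb.1; have [n _ en] := hc.1.
have [|_ hm] := hN n m; first by rewrite en em dC; move: kap0; lra.
by rewrite -em; move: (hD1 _ hm) kap0; lra.
Qed.

(* The axes of [g] and of its conjugate by [h^n] project close to [o] and to [h^n o] on the
   axis of [h], and these two points are far apart. *)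
Lemma axis_separation K : independent mul inv one d act o g h -> 0 < K ->
  quasigeodesic d K (fun n => act (pw h n) o) ->
  exists (D3 : R) (l0 : nat), 0 <= D3 /\ forall n : int, (l0 <= `|n|)%N ->
    forall a p, axis g a -> proj d (axis g) (act (pw h n) a) p -> d p o <= D3.
Proof.
move=> ind K0 qh; have [D [D0 hD]] := axis_proj_bounded ind.
(* From this power on, o and [h^n o] are more than [2 * D + kap] apart, so the two projections, each
   within [D] of one of them, are more than [kap] apart. *)
pose l0 := Num.bound (K * (2 * D + kap + K + 1)).
exists (2 * D + kap), l0; split; first by move: kap0; lra.
move=> n hn a p ha hp.
have hl : 2 * D + kap + 1 <= d o (act (pw h n) o).
  have [+ _] := qh n 0; rewrite subr0 dC {2}/gpowz /= act1.
  apply: le_trans; rewrite lerBrDr ler_pdivlMr //.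
  have : 0 <= K * (2 * D + kap + K + 1).
    by apply: mulr_ge0; move: kap0 K0; lra.
  move=> /archi_boundP/ltW; rewrite -/l0 => h1.
  have : (l0%:R : R) <= `|n%:~R|.
    by rewrite -intr_norm -[`|n|]/(Posz `|n|%N) ler_nat.
  by move: h1; lra.
have [b hb] := Bc.1 p; have [b' hb'] := Bc.1 a.
have hob := hD _ _ hp.1 hb; have hob' := hD _ _ ha hb'.
have hyb : proj d (axis h) (act (pw h n) a) (act (pw h n) b').
  by apply/proj_act => // y; apply: axis_act.
have e1 := actd (pw h n) o b'.
have t1 := d_tri o b (act (pw h n) b'); have t2 := d_tri o (act (pw h n) b') (act (pw h n) o).
have : d p b + d b (act (pw h n) b') + d (act (pw h n) b') (act (pw h n) a)
    <= d p (act (pw h n) a) + kap.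
  by apply: Bc.2 => //; rewrite (dC (act _ b')) in t2; lra.
(* The point o lies on the axis of [g], so [p] is at least as close as o to the projected point;
   entering the axis of [h] far from o would be a detour. *)
have := proj_le hp (axis_base g).
set y := act _ a; set y' := act _ b'; rewrite (dC y o) (dC y p).
have := d_tri o y' y; have := d_tri p b o; rewrite (dC b o).
rewrite -/y' (dC y') in t2 e1.
move: t1; rewrite -/y'; lra.
Qed.

End Axes.

Definition len (w : G) : R := d o (act w o).

Lemma len_ge0 w : 0 <= len w. Proof. exact: d_ge0. Qed.

Let len_mul a b : len (mul a b) <= len a + len b.
Proof. by rewrite /len actM; have := d_tri o (act a o) (act a (act b o)); rewrite actd. Qed.

Let lenV a : len (inv a) = len a.
Proof. by rewrite /len dC dV. Qed.

Let len_mulr_ge a b : len a - len b <= len (mul a b).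
Proof.
have := len_mul (mul a b) (inv b); rewrite lenV -mulA mulgV mulr1; lra.
Qed.

Let len_mull_ge a b : len b - len a <= len (mul a b).
Proof.
have := len_mul (inv a) (mul a b); rewrite lenV mulA mulVg mul1; lra.
Qed.

(** * Translates of one contracting set *)

Section Translates.
Variables (I : Type) (A : set X) (kap D0 D3 : R) (u : I -> G).
Hypotheses (Ac : strongly_contracting d kap A) (Ao : A o).
Hypothesis uD0 : forall i, len (u i) <= D0.
Hypothesis usep : forall i j, i <> j -> forall a p, A a ->
  proj d A (act (mul (inv (u j)) (u i)) a) p -> d p o <= D3.

(* If [x] projects far from [o] on both [u i A] and [u j A], then a geodesic from [x] to [o]
   passes near the projection to [u i A], and a geodesic from [x] to that projection passes
   near [o]. *)
Lemma far_translate_unique x i j q q' : 0 <= D3 -> 0 <= kap -> i <> j ->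
  proj d A (act (inv (u i)) x) q -> proj d A (act (inv (u j)) x) q' ->
  2 * D0 + D3 + kap < d q o -> d q' o <= 2 * D0 + D3 + kap.
Proof.
move=> D30 kap0 ij hq hq' hqo; rewrite leNgt; apply/negP => hq'o.
have [c hc] := Ac.1 (act (inv (u i)) o).
have [p hp] := Ac.1 (act (mul (inv (u j)) (u i)) q).
have hpo := usep ij hq.1 hp.
have h1 := Ac.2 _ _ _ _ hq hc; rewrite actd in h1.
have hui : d o (act (inv (u i)) o) = len (u i) by rewrite -lenV.
have hco : d c o <= 2 * D0.
  have := proj_le hc Ao; have := d_tri c (act (inv (u i)) o) o.
  have := uD0 i; rewrite (dC (act _ o) c) (dC (act _ o) o) hui; lra.
have h2 := Ac.2 _ _ _ _ hq' hp.
have e2 : d (act (inv (u j)) x) (act (mul (inv (u j)) (u i)) q) = d (act (inv (u i)) x) q.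
  by rewrite actM actd dV.
rewrite e2 in h2.
have t1 := d_tri q c o; have t2 := d_tri q' p o.
have [k1|k1] := lerP (d q c) kap.
  by have := len_ge0 (u i); have := uD0 i; lra.
have [k2|k2] := lerP (d q' p) kap.
  by have := len_ge0 (u i); have := uD0 i; lra.
have {}h1 := h1 k1; have {}h2 := h2 k2.
set y := act (inv (u j)) x in h2 hq'; set r := act (mul _ _) q in h2.
have t3 := d_tri y q' p; have t4 := d_tri y p o; have t5 := d_tri o p r.
have t6 : d x o <= d y o + D0.
  rewrite /y dV; have := d_tri x (act (u j) o) o; have := uD0 j.
  by rewrite (dC (act _ o)) -/(len _); lra.
have t7 : d q o - 2 * D0 <= d o r.
  rewrite /r actM (dC o) dV -(actd (u i) q o).
  have := d_tri (act (u i) q) (act (u j) o) (act (u i) o).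
  have := d_tri (act (u j) o) o (act (u i) o).
  rewrite (dC (act _ o) o) -!/(len _); have := uD0 i; have := uD0 j; lra.
have t9 : d q o - D0 <= d q (act (inv (u i)) o).
  by have := d_tri q (act (inv (u i)) o) o; have := uD0 i; rewrite (dC (act _ o) o) hui; lra.
have t8 := d_tri q c (act (inv (u i)) o).
(* The sum of all these inequalities reads [2 * d q o <= 2 * (2 * D0 + D3 + kap)], whence the
   threshold. *)
rewrite (dC o p) in t5.
lra.
Qed.

End Translates.

(** * Alignment and additivity of lengths *)

Section Alignment.
Variables (g : G) (kap D0 : R).
Hypotheses (kap0 : 0 <= kap) (Ac : strongly_contracting d kap (axis g)).

(* [w^-1 o] projects within [D] of the base point of the translate of the axis by [t], with
   everything pulled back to the axis itself. *)
Definition aligned_right (D : R) (w t : G) : Prop :=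
  forall p, proj d (axis g) (act (inv (mul w t)) o) p -> d p o <= D.

Definition aligned_left (D : R) (t w : G) : Prop :=
  forall p, proj d (axis g) (act (mul t w) o) p -> d p o <= D.

(** Pulled back to the axis, the two ends of [v s w] project near o and near [g^M o], which are far
    apart, so strong contraction applies. The second bound compares with [v s] instead of [v], and
    its constant is free of [D']: this keeps the alignment constant from growing when letters are
    added. *)
Lemma aligned_len D D' v t (M : int) w (s := mul t (mul (pw g M) t)) :
  len t <= D0 -> D + D' + kap < len (pw g M) ->
  aligned_right D' v t -> aligned_left D t w ->
  len v + len w - (D + D' + 2 * D0 + kap) <= len (mul v (mul s w)) /\
  len (mul v s) + len w - (2 * D + 2 * D0 + kap) <= len (mul v (mul s w)).
Proof.
move=> tD0 hM hv hw.
set z := act (inv (mul v t)) o; have [a ha] := Ac.1 z.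
set y := act (mul t w) o; have [b hb] := Ac.1 y.
have ha' := hv _ ha; have hb' := hw _ hb.
have hgb : proj d (axis g) (act (pw g M) y) (act (pw g M) b).
  by apply/proj_act => // x; apply: axis_act.
have := Ac.2 _ _ _ _ ha hgb; rewrite actd => h1.
have hz c : d z (act c o) = len (mul (mul v t) c).
  by rewrite /z dV -actM.
have hzo : d z o = len (mul v t) by rewrite /z dV.
have hzy : d z (act (pw g M) y) = len (mul v (mul s w)).
  by rewrite /y -actM hz /s !mulA.
have hy : d o y = len (mul t w) by [].
have hzg : len (mul v s) - D0 <= d z (act (pw g M) o).
  by rewrite hz; have := len_mul (mul (mul v t) (pw g M)) t; rewrite /s !mulA; lra.
have k1 : kap < d a (act (pw g M) b).
  have := d_tri o a (act (pw g M) o); have := d_tri a (act (pw g M) b) (act (pw g M) o).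
  by rewrite actd (dC o a) -/(len _); lra.
have {}h1 := h1 k1; rewrite hzy in h1.
have t1 := d_tri z a o; rewrite hzo in t1.
have t2 := d_tri o b y; rewrite (dC o b) hy in t2.
have t3 := d_tri z a (act (pw g M) b); have t4 := d_tri z (act (pw g M) b) (act (pw g M) o).
rewrite actd in t4.
have t5 := len_mulr_ge v t; have t6 := len_mull_ge t w.
have t7 := d_ge0 a (act (pw g M) b).
by split; lra.
Qed.

(** If the projection of the whole prefix were far from o while that of [w] is near, the path from
    one end to the other would pass near o, hence [len w] would be subtracted from [len (v s)]
    instead of added. Comparing with [aligned_len] gives [len w <= 2 * D + 2 * D0 + kap]. *)
Lemma aligned_right_step D D' v t (M : int) w t' (s := mul t (mul (pw g M) t)) :
  len t <= D0 -> len t' <= D0 -> D + D' + kap < len (pw g M) ->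
  aligned_right D' v t -> aligned_left D t w -> aligned_right D w t' ->
  2 * D + 2 * D0 + kap < len w -> aligned_right (D + kap) (mul v (mul s w)) t'.
Proof.
move=> tD0 tD0' hM hv hw hwt hE q hq.
have [_ h1] := aligned_len tD0 hM hv hw; rewrite -/s in h1.
set y := act _ o in hq; set y' := act (inv (mul w t')) o.
have [q' hq'] := Ac.1 y'; have hq'o := hwt _ hq'.
rewrite leNgt; apply/negP => hqo.
have k1 : kap < d q q' by have := d_tri q q' o; lra.
have h2 := Ac.2 _ _ _ _ hq hq' k1.
have hyo : d y o = len (mul (mul v (mul s w)) t') by rewrite /y dV.
have hyo' : d y' o = len (mul w t') by rewrite /y' dV.
have hyy : d y y' = len (mul v s).
  rewrite /y dV /y' -actM; congr (d o (act _ o)).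
  by rewrite invM !mulA -(mulA _ t') mulgV mulr1 -(mulA _ w) mulgV mulr1.
have t1 := d_tri y q' o; have t2 := d_tri y q q'; have t3 := d_tri y' q' o.
rewrite (dC y' q') hyo' in t3; rewrite hyo in t1; rewrite hyy in h2.
have t4 := len_mulr_ge (mul v (mul s w)) t'; have t5 := len_mulr_ge w t'.
lra.
Qed.

End Alignment.

Lemma strongly_contracting_le kap kap' A : kap <= kap' ->
  strongly_contracting d kap A -> strongly_contracting d kap' A.
Proof.
move=> hk [h1 h2]; split=> // x y a b ha hb hab.
by have := h2 _ _ _ _ ha hb (le_lt_trans hk hab); lra.
Qed.

Hypothesis geo : is_geodesic_space d.

(** All the geometry that pivoting uses. [GR] is alignment of the last piece alone; [GR2] is the
    weaker alignment of a whole prefix, which the last clause propagates from piece to piece with a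
    fixed constant. *)
Lemma schottky_family (S : set G) (k : nat) :
  (exists g h : G, in_semigroup mul S g /\ in_semigroup mul S h /\
     contracting_isometry mul inv one d act o g /\
     contracting_isometry mul inv one d act o h /\
     independent mul inv one d act o g h) ->
  exists (m : nat) (s : 'I_k -> G) (GR GR2 : G -> 'I_k -> Prop)
    (GL : 'I_k -> G -> Prop) (E : R), 0 <= E /\
    (forall i, is_word mul one S m (s i)) /\
    (forall w i j, ~ GR w i -> ~ GR w j -> i = j) /\
    (forall w i j, ~ GL i w -> ~ GL j w -> i = j) /\
    (forall w i, GR w i -> GR2 w i) /\
    (forall v i w, GR2 v i -> GL i w -> len v + len w - E <= len (mul v (mul (s i) w))) /\
    (forall v i w j, GR2 v i -> GL i w -> E <= len w -> GR w j ->
       GR2 (mul v (mul (s i) w)) j).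
Proof.
move=> [g [h [Sg [Sh [[Kg [Kg0 [qg cg]]] [[Kh [Kh0 [qh ch]]] ind]]]]]].
have sg := contracting_strongly dm geo Kg0 cg.
have sh := contracting_strongly dm geo Kh0 ch.
pose kap := 52 * Kg + 52 * Kh.
have kap0 : 0 <= kap by rewrite /kap; lra.
have Ac : strongly_contracting d kap (axis g).
  by apply: strongly_contracting_le sg; rewrite /kap; lra.
have Bc : strongly_contracting d kap (axis h).
  by apply: strongly_contracting_le sh; rewrite /kap; lra.
have [D3 [l0 [D30 sep]]] := axis_separation kap0 Ac Bc ind Kh0 qh.
have [lg wg] := semigroup_word mulA mulr1 Sg.
have [lh wh] := semigroup_word mulA mulr1 Sh.
(* The factor [l1] separates the powers of [h]. The factor [lg.+1] makes the length gained by
   raising the power of [h] a multiple of the length of [g], so that [M] can compensate it exactly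
   and all letters get length [m]. *)
pose l1 := l0.+1; pose l := (l1 * lg.+1)%N.
pose t (i : 'I_k) := pw h (l * i.+1)%N.
pose D0 := \sum_(i < k) len (t i).
have tD0 i : len (t i) <= D0.
  rewrite /D0 (bigD1 i) //= lerDl; apply: sumr_ge0 => j _; exact: len_ge0.
(* The threshold of [far_translate_unique]. *)
pose D := 2 * D0 + D3 + kap.
have D00 : 0 <= D0 by apply: sumr_ge0 => i _; apply: len_ge0.
pose M0 := Num.bound (Kg * (2 * D + 2 * kap + Kg + 1)).
pose M (i : 'I_k) := (M0 + 2 * l1 * lh.+1 * (k - i.+1))%N.
have hM i : D + (D + kap) + kap < len (pw g (M i)).
  have [+ _] := qg (M i) 0; rewrite subr0 dC {2}/gpowz /= act1 -/(len _).
  apply: lt_le_trans; rewrite ltrBrDr ltr_pdivlMr //.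
  have : 0 <= Kg * (2 * D + 2 * kap + Kg + 1).
    by apply: mulr_ge0; rewrite /D; lra.
  move=> /archi_boundP; rewrite -/M0 => h1.
  have : (M0%:R : R) <= `|(M i)%:~R|.
    by rewrite ger0_norm ?ler0z // -[_%:~R]/((M i)%:R) ler_nat /M leq_addr.
  by move: h1; lra.
pose s i := mul (t i) (mul (pw g (M i)) (t i)).
pose m := (M0 * lg.+1 + 2 * l1 * lg.+1 * lh.+1 * k)%N.
have hsep (b : bool) (i j : 'I_k) : i <> j -> forall a p, axis g a ->
    proj d (axis g) (act (pw h ((-1) ^+ b * ((l * i.+1)%:Z - (l * j.+1)%:Z))) a) p ->
    d p o <= D3.
  move=> ij a p ha; apply: sep => //.
  rewrite abszM abszX exp1n mul1n.
  have : i != j :> nat by apply/eqP => /ord_inj.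
  rewrite /l /l1; clear; nia.
exists m, s, (fun w i => aligned_right g D w (t i)), (fun w i => aligned_right g (D + kap) w (t i)),
  (fun i w => aligned_left g D (t i) w), (D + (D + kap) + 2 * D0 + kap + 1).
split; first by rewrite /D; lra.
split.
  move=> i; have -> : m = (l * i.+1 * lh.+1 + (M i * lg.+1 + l * i.+1 * lh.+1))%N.
    rewrite /m /M /l; have := ltn_ord i; clear; nia.
  apply: is_word_mul => //; first exact: is_word_pow.
  by apply: is_word_mul => //; apply: is_word_pow.
(* The sign selects the side: right alignment projects after applying the inverse of [t i], left
   alignment after applying [t i], which amounts to the family of opposite powers of [h]. *)
have bad (b : bool) x (i j : 'I_k) q q' : i <> j ->
    proj d (axis g) (act (inv (pw h ((-1) ^+ b * (l * i.+1)%:Z))) x) q ->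
    proj d (axis g) (act (inv (pw h ((-1) ^+ b * (l * j.+1)%:Z))) x) q' ->
    D < d q o -> d q' o <= D.
  pose u (i : 'I_k) := pw h ((-1) ^+ b * (l * i.+1)%:Z).
  apply: (@far_translate_unique _ (axis g) kap D0 D3 u) => //; first exact: axis_base.
    move=> i'; apply: le_trans (tD0 i'); rewrite /u /t; case: (b).
      by rewrite expr1 mulN1r gpowzN lenV.
    by rewrite expr0 mul1r.
  move=> i' j' ij' a p ha; rewrite /u -gpowzN -gpowzD.
  have -> : - ((-1) ^+ b * (l * j'.+1)%:Z) + (-1) ^+ b * (l * i'.+1)%:Z
     = (-1) ^+ b * ((l * i'.+1)%:Z - (l * j'.+1)%:Z) by ring.
  by apply: (hsep b).
have notall (Q : X -> Prop) (b : X -> R) : ~ (forall p, Q p -> b p <= D) ->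
    exists2 p, Q p & D < b p.
  move=> hn; apply: contrapT => hn'; apply: hn => p Qp; rewrite leNgt; apply/negP => hp.
  by apply: hn'; exists p.
split.
  move=> w i j /notall[q hq hqo] /notall[q' hq' hqo']; apply: contrapT => ij.
  rewrite invM actM in hq; rewrite invM actM in hq'.
  by have := @bad false _ i j q q' ij; rewrite !expr0 !mul1r => /(_ _ hq hq' hqo); rewrite leNgt hqo'.
split.
  move=> w i j /notall[q hq hqo] /notall[q' hq' hqo']; apply: contrapT => ij.
  rewrite actM in hq; rewrite actM in hq'.
  have := @bad true (act w o) i j q q' ij; rewrite !expr1 !mulN1r -!gpowzN !opprK.
  by move=> /(_ hq hq' hqo); rewrite leNgt hqo'.
split.
  by move=> w i hw p hp; have := hw p hp; lra.
split.
  move=> v i w hv hw; have [+ _] := aligned_len Ac (tD0 i) (hM i) hv hw.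
  by rewrite -/(s i); lra.
move=> v i w j hv hw hE hj.
by apply: aligned_right_step hv hw hj _ => //; move: hE; rewrite /D; lra.
Qed.

End Schottky.

(** * Pivoting *)

Lemma sum_few_le (R : realType) (k : nat) (Q : pred 'I_k) (a : 'I_k -> R) (c : R) :
  (forall i j, Q i -> Q j -> i = j) -> 0 <= c -> (forall i, a i <= c) ->
  \sum_(i | Q i) a i <= c.
Proof.
move=> hQ c0 ha; case: (pickP Q) => [i Qi|Q0]; last by rewrite big_pred0.
rewrite (bigD1 i) //= big1 ?addr0 // => j /andP[Qj]; by rewrite (hQ _ _ Qj Qi) eqxx.
Qed.

Section Pivot.
Variables (R : realType) (G : Type) (mul : G -> G -> G) (one : G).
Hypotheses (mulA : forall a b c, mul a (mul b c) = mul (mul a b) c)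
  (mul1g : forall a, mul one a = a).
Variables (len : G -> R) (k : nat) (s : 'I_k -> G).
Variables (GR GR2 : G -> 'I_k -> Prop) (GL : 'I_k -> G -> Prop) (E B : R).
Hypotheses (len0 : forall w, 0 <= len w) (E0 : 0 <= E)
  (badR : forall w i j, ~ GR w i -> ~ GR w j -> i = j)
  (badL : forall w i j, ~ GL i w -> ~ GL j w -> i = j)
  (GRW : forall w i, GR w i -> GR2 w i)
  (GRL_len : forall v i w, GR2 v i -> GL i w ->
     len v + len w - E <= len (mul v (mul (s i) w)))
  (GRL_step : forall v i w j, GR2 v i -> GL i w -> E <= len w -> GR w j ->
     GR2 (mul v (mul (s i) w)) j)
  (EB : 2 * E < B).

Local Notation e := (expR 1 : R).
Local Notation eV := (expR (- 1) : R).
Hypothesis ke : 4 * e <= k%:R.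

Let e2 : 2 <= e. Proof. by apply: le_trans (expR_ge1Dx _); lra. Qed.
Let eVe : eV * e = 1. Proof. by rewrite -expRD addNr expR0. Qed.
Let eV0 : 0 < eV. Proof. exact: expR_gt0. Qed.
Let k0 : 0 < k%:R :> R. Proof. by move: ke e2; lra. Qed.
Let kV0 : 0 < k%:R^-1 :> R. Proof. by rewrite invr_gt0. Qed.
Let kVk : k%:R^-1 * k%:R = 1 :> R. Proof. by rewrite mulVf // gt_eqF. Qed.
Let kVe : k%:R^-1 * (4 * e) <= 1.
Proof. by have := ke; rewrite -(ler_pM2l kV0) kVk. Qed.

Definition decay (w : G) : R := expR (- (len w / (B - E))).
Definition avg (a : 'I_k -> R) : R := k%:R^-1 * \sum_i a i.

(* A stack lists, last slot first, the slots of a word [v1 s_i1 v2 s_i2 ... vr s_ir w] whose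
   indices are still random: the index of the slot after [v] ranges over [A], but is weighted
   by [1/k], so that shrinking [A] only decreases the sum. *)
Fixpoint stack_sum (st : seq ({set 'I_k} * G)) (w : G) (f : G -> R) : R :=
  match st with
  | [::] => f w
  | (A, v) :: st' => k%:R^-1 * \sum_(i in A) stack_sum st' (mul v (mul (s i) w)) f
  end.

Fixpoint stack_word (st : seq ({set 'I_k} * G)) (x : G) : Prop :=
  match st with
  | [::] => x = one
  | (A, v) :: st' => exists y i, stack_word st' y /\ i \in A /\ x = mul y (mul v (s i))
  end.

Definition top_aligned (st : seq ({set 'I_k} * G)) (w : G) : Prop :=
  if st is (A, _) :: _ then forall i, i \in A -> GL i w else True.

(** Alignment is required for every index left in [A], so it holds for all realisations of the stack
    at once. *)
Fixpoint stack_valid (st : seq ({set 'I_k} * G)) : Prop :=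
  match st with
  | [::] => True
  | (A, v) :: st' => (forall i, i \in A -> GR v i) /\ B <= len v /\
      top_aligned st' v /\ stack_valid st'
  end.

Lemma stack_sum_le st w f c : 0 <= c ->
  (forall x, stack_word st x -> f (mul x w) <= c) -> stack_sum st w f <= c.
Proof.
move=> c0; elim: st w => [|[A v] st IH] w h /=; first by have := h one erefl; rewrite mul1g.
have hi i : i \in A -> stack_sum st (mul v (mul (s i) w)) f <= c.
  move=> iA; apply: IH => x hx; have := h (mul x (mul v (s i))).
  by rewrite -!mulA; apply; exists x, i.
have : \sum_(i in A) stack_sum st (mul v (mul (s i) w)) f <= k%:R * c.
  apply: le_trans (ler_sum _ hi) _; rewrite sumr_const mulr_natl.
  by rewrite -!(mulr_natl c); apply: (ler_wpM2r c0); rewrite ler_nat -[leqRHS]card_ord max_card.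
by move=> h1; rewrite /= -(ler_pM2l k0) mulrA divff ?gt_eqF // mul1r.
Qed.

Lemma stack_sum_avg st w (f : 'I_k -> G -> R) :
  stack_sum st w (fun x => avg (fun i => f i x)) = avg (fun i => stack_sum st w (f i)).
Proof.
elim: st w => [|[A v] st IH] w //=.
under eq_bigr do rewrite IH.
rewrite /avg -mulr_sumr exchange_big /= mulr_sumr; congr (_ * _).
Qed.

Lemma stack_sum_shift st w z f :
  stack_sum st w (fun x => f (mul x z)) = stack_sum st (mul w z) f.
Proof.
elim: st w => [|[A v] st IH] w //=; congr (_ * _); apply: eq_bigr => i _.
by rewrite IH -!mulA.
Qed.

(** Each piece has length at least [B] and each junction loses at most [E]. The alignment of the
    prefix is carried along because the next junction needs it. *)
Lemma stack_word_len A v st y : stack_valid ((A, v) :: st) -> stack_word st y ->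
  (forall i, i \in A -> GR2 (mul y v) i) /\ (size st).+1%:R * (B - E) <= len (mul y v).
Proof.
elim: st A v y => [|[A1 v1] st IH] A v y /= [hR [hB [htop hv]]].
  move=> ->; rewrite mul1g; split; first by move=> i iA; apply: GRW; apply: hR.
  by move: hB E0; lra.
move=> [y1 [i [hy1 [iA ->]]]]; have [h1 h2] := IH _ _ _ hv hy1.
have hl := htop _ iA.
rewrite -!mulA mulA; split.
  by move=> j jA; apply: GRL_step; [exact: h1 | | move: hB EB E0; lra | exact: hR].
have := GRL_len (h1 _ iA) hl; rewrite /= -[(size st).+2%:R]natr1 mulrDl mul1r.
by move: hB; lra.
Qed.

Lemma decay_le1 w : decay w <= 1.
Proof.
rewrite -expR0 ler_expR oppr_le0; apply: divr_ge0; first exact: len0.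
by move: EB E0; lra.
Qed.

(** The last junction, with [w] possibly short, may lose [E]; as [E < B - E] this is less than the
    gain of one slot, hence the factor e. *)
Lemma stack_sum_aligned st w : stack_valid st -> top_aligned st w ->
  stack_sum st w decay <= e * eV ^+ size st.
Proof.
case: st => [|[A v] st] hv hw.
  by rewrite /= expr0 mulr1; have := decay_le1 w; move: e2; lra.
apply: stack_sum_le; first by apply: mulr_ge0; [exact: expR_ge0 | exact: exprn_ge0 (ltW eV0)].
move=> _ [y [i [hy [iA ->]]]]; have [h1 h2] := stack_word_len hv hy.
have h3 := GRL_len (h1 _ iA) (hw _ iA).
have -> : e * eV ^+ (size ((A, v) :: st)) = expR (1 - (size st).+1%:R).
  by rewrite /= -expRM_natl -expRD; congr expR; ring.
have BE : 0 < B - E by move: EB E0; lra.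
rewrite ler_expR lerNl opprB ler_pdivlMr // mulrBl mul1r.
by have := len0 w; rewrite -!mulA; move: h2 h3 EB; rewrite -!mulA; lra.
Qed.

Lemma stack_sum_split A v st w f :
  stack_sum ((A, v) :: st) w f =
  stack_sum (([set i in A | `[< GL i w >]], v) :: st) w f +
  k%:R^-1 * \sum_(i in A | ~~ `[< GL i w >]) stack_sum st (mul v (mul (s i) w)) f.
Proof.
rewrite /= -mulrDr; congr (_ * _); rewrite (bigID (fun i => `[< GL i w >])) /=.
by congr (_ + _); apply: eq_bigl => i; rewrite inE.
Qed.

Lemma stack_valid_sub A v st w : stack_valid ((A, v) :: st) ->
  stack_valid (([set i in A | `[< GL i w >]], v) :: st) /\
  top_aligned (([set i in A | `[< GL i w >]], v) :: st) w.
Proof.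
move=> [hR h]; split; last by move=> i; rewrite inE => /andP[_ /asboolP].
by split=> // i; rewrite inE => /andP[/hR].
Qed.

Lemma bad_left_le (A : {set 'I_k}) w (a : 'I_k -> R) c : 0 <= c -> (forall i, a i <= c) ->
  \sum_(i in A | ~~ `[< GL i w >]) a i <= c.
Proof.
move=> c0 ha; apply: sum_few_le => // i j /andP[_ /asboolPn hi] /andP[_ /asboolPn hj].
exact: badL hi hj.
Qed.

(** Of the factor 2e, one e is the aligned part; the other pays for the single misaligned index of
    the last slot, which is dissolved into [w]: its weight 1/k compensates the lost slot because
    [2 * e <= k]. *)
Lemma stack_sum_decay st w : stack_valid st ->
  stack_sum st w decay <= 2 * e * eV ^+ size st.
Proof.
elim: st w => [|[A v] st IH] w hv.
  by rewrite expr0 mulr1 /=; have := decay_le1 w; move: e2; lra.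
rewrite stack_sum_split; have [hv' ht] := stack_valid_sub w hv.
have h1 := stack_sum_aligned hv' ht; rewrite /= -/(size _) in h1.
have hst : stack_valid st by case: hv => _ [_ []].
have h2 : \sum_(i in A | ~~ `[< GL i w >]) stack_sum st (mul v (mul (s i) w)) decay
    <= 2 * e * eV ^+ size st.
  apply: bad_left_le => [|i]; last exact: IH.
  by apply: mulr_ge0; [move: e2; lra | exact: exprn_ge0 (ltW eV0)].
rewrite -(ler_pM2l kV0) in h2.
have h3 : k%:R^-1 * (2 * e * eV ^+ size st) <= e * eV ^+ (size st).+1.
  rewrite exprS mulrA [e * _]mulrC eVe mul1r -[leRHS]mul1r mulrA.
  apply: ler_wpM2r; first exact: exprn_ge0 (ltW eV0).
  by move: kVe e2 kV0; nra.
rewrite /= in h1 h2 h3 *; lra.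
Qed.

(** * Costs of the pivoting step *)

Local Notation Y := (2 * e).
Local Notation x := (eV + 4 * e / k%:R).

(** A long pending element is ready to become a slot; a short one must first absorb a letter and a
    new piece, which gains no slot, and [Y] is the price of that delay. *)
Definition pending_cost (w : G) : R := if B <= len w then 1 else Y.
(** The threshold exceeds [B] by [E] so that absorbing an aligned long piece leaves the pending
    element long. *)
Definition step_cost (w : G) : R := if B + E <= len w then x else Y ^+ 2.

Definition prod_cost (ws : seq G) : R := \prod_(w <- ws) step_cost w.

Let x0 : 0 < x.
Proof. by rewrite ltr_wpDr // divr_ge0 // ?ltW //; move: e2; lra. Qed.

Lemma step_cost_ge0 w : 0 <= step_cost w.
Proof. by rewrite /step_cost; case: ifP => _; [exact: ltW | exact: sqr_ge0]. Qed.

Lemma prod_cost_ge0 ws : 0 <= prod_cost ws.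
Proof. by apply: prodr_ge0 => w _; exact: step_cost_ge0. Qed.

Fixpoint word_avg (f : G -> R) (ws : seq G) (z : G) : R :=
  match ws with
  | [::] => f z
  | w :: ws' => avg (fun i => word_avg f ws' (mul z (mul (s i) w)))
  end.

(** The two terms [Y / k] stand for the at most two indices misaligned with the pending element or
    with [w1]. *)
Definition append_cost (w1 : G) : R := if B + E <= len w1 then 1 + 2 * (k%:R^-1 * Y) else Y.

Lemma pending_cost_le w : 1 <= pending_cost w <= Y.
Proof. by rewrite /pending_cost; case: ifP => _; rewrite ?lexx ?andbT //=; move: e2; lra. Qed.

Lemma avg_pending w w1 : avg (fun i => pending_cost (mul w (mul (s i) w1))) <= append_cost w1.
Proof.
have Y0 : 0 <= Y by move: e2; lra.
rewrite /avg -(ler_pM2l k0) mulrA divff ?gt_eqF // mul1r /append_cost; case: ifP => hw1; last first.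
  have -> : k%:R * Y = \sum_(i < k) Y by rewrite sumr_const card_ord mulr_natl.
  by apply: ler_sum => i _; case/andP: (pending_cost_le (mul w (mul (s i) w1))).
have -> : k%:R * (1 + 2 * (k%:R^-1 * Y)) = \sum_(i < k) (1 : R) + Y + Y.
  by rewrite sumr_const card_ord mulrDr mulr1 !mulrA -[_ * 2 * _]mulrAC divff ?gt_eqF //; ring.
have hi i : pending_cost (mul w (mul (s i) w1)) <=
    1 + ((if `[< GR w i >] then 0 else Y) + (if `[< GL i w1 >] then 0 else Y)).
  have := pending_cost_le (mul w (mul (s i) w1)) => /andP[_ h].
  case: asboolP => h1; case: asboolP => h2; try by move: e2; lra.
  rewrite /pending_cost ifT; first by lra.
  by have := GRL_len (GRW h1) h2; have := len0 w; move: hw1; lra.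
apply: le_trans (ler_sum _ (fun i _ => hi i)) _.
rewrite big_split big_split /= -addrA; apply: lerD => //; apply: lerD.
  under eq_bigr do rewrite -if_neg; rewrite -big_mkcond /=.
  by apply: sum_few_le => // i j /asboolPn hi' /asboolPn; apply: badR hi'.
under eq_bigr do rewrite -if_neg; rewrite -big_mkcond /=.
by apply: sum_few_le => // i j /asboolPn hi' /asboolPn; apply: badL hi'.
Qed.

(** For long [w1] the choice of [Y] shows: [Y * eV] is 2, while [append_cost] is at most 2. *)
Lemma append_cost_short w1 : append_cost w1 <= Y * step_cost w1.
Proof.
rewrite /append_cost /step_cost; case: ifP => _; last by move: e2; nra.
have h : 0 <= e / k%:R by rewrite divr_ge0 //; move: e2; lra.
have : k%:R^-1 * Y <= 2^-1 by move: kVe; lra.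
move: eVe e2; nra.
Qed.

(** The three terms are a new slot, a new letter misaligned with the pending element, and a
    dissolved last slot. For long [w1] the last two contribute at most 2e/k each, which is the 4e/k
    of [x]. *)
Lemma append_cost_long w1 :
  eV * pending_cost w1 + k%:R^-1 * Y + k%:R^-1 * (e * append_cost w1) <= step_cost w1.
Proof.
have h : k%:R^-1 * Y <= 2^-1 by move: kVe; lra.
have e0 : 0 <= e := expR_ge0 1.
have eV1 : eV <= 1.
  by have : 0 <= eV * (e - 2) by [rewrite mulr_ge0 ?(ltW eV0) // subr_ge0]; rewrite mulrBr eVe; lra.
rewrite /append_cost /step_cost /pending_cost; case: (ifP (B + E <= len w1)) => hw.
  rewrite ifT; last by move: E0 hw; lra.
  have : 1 + 2 * (k%:R^-1 * Y) <= 2 by lra.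
  by move=> /(ler_wpM2l e0)/(ler_wpM2l (ltW kV0)); rewrite mulr1 [4 * e / _]mulrC; lra.
have Y4 : 4 <= Y by move: e2; lra.
have h3 : k%:R^-1 * (e * Y) <= 2^-1 * Y.
  by rewrite [leLHS]mulrA; apply: ler_wpM2r; [lra | move: kVe; lra].
have h4 : eV * (if B <= len w1 then 1 else Y) <= Y.
  rewrite -[leRHS]mul1r; by apply: ler_pM => //; case: ifP => _; lra.
have : 4 * Y <= Y ^+ 2 by rewrite expr2; apply: ler_wpM2r; lra.
by lra.
Qed.

(* The pivoting step.  If the pending element [w] is long and aligned with the last slot and
   with the new letter, a slot is created.  The last slot has at most one misaligned index: on
   it, that slot is dissolved into the pending element. *)
Lemma pivot_bound ws st w : stack_valid st ->
  stack_sum st w (word_avg decay ws) <=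
  2 * e * eV ^+ size st * (pending_cost w * prod_cost ws).
Proof.
elim: ws st w => [|w1 ws IH] st w hst.
  rewrite /prod_cost big_nil mulr1; apply: le_trans (stack_sum_decay w hst) _.
  have /andP[h _] := pending_cost_le w; apply: ler_peMr => //.
have P0 := prod_cost_ge0 ws.
have Ge0 (st' : seq ({set 'I_k} * G)) : 0 <= 2 * e * eV ^+ size st'.
  by apply: mulr_ge0; [move: e2; lra | exact: exprn_ge0 (ltW eV0)].
have unfold_avg st' w' : stack_sum st' w' (word_avg decay (w1 :: ws)) =
    avg (fun i => stack_sum st' (mul w' (mul (s i) w1)) (word_avg decay ws)).
  rewrite /= stack_sum_avg; congr avg; apply/funext => i.
  by rewrite (stack_sum_shift _ _ _ (word_avg decay ws)).
(* Here the new letter is absorbed into the pending element for every index, without creating a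
   slot. *)
have dirty st' w' : stack_valid st' -> stack_sum st' w' (word_avg decay (w1 :: ws)) <=
    2 * e * eV ^+ size st' * (append_cost w1 * prod_cost ws).
  move=> hv; rewrite unfold_avg; set c := 2 * e * _.
  apply: (@le_trans _ _ (c * (avg (fun i => pending_cost (mul w' (mul (s i) w1))) * prod_cost ws))).
    have -> : c * (avg (fun i => pending_cost (mul w' (mul (s i) w1))) * prod_cost ws) =
      avg (fun i => c * (pending_cost (mul w' (mul (s i) w1)) * prod_cost ws)).
      by rewrite /avg -mulr_sumr -mulr_suml; ring.
    by rewrite /avg ler_pM2l //; apply: ler_sum => i _; apply: IH.
  by apply: ler_wpM2l; [exact: Ge0 | apply: ler_wpM2r => //; apply: avg_pending].
rewrite /prod_cost big_cons -/(prod_cost ws).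
have [hw|hw] := lerP B (len w); last first.
  apply: le_trans (dirty _ _ hst) _; apply: ler_wpM2l => //.
  rewrite mulrA; apply: ler_wpM2r => //.
  by rewrite /pending_cost ifF; [exact: append_cost_short | rewrite leNgt hw].
(* Here the indices aligned with [w] form a new slot; the at most one other index is absorbed. *)
have clean st' : stack_valid st' -> top_aligned st' w ->
    stack_sum st' w (word_avg decay (w1 :: ws)) <=
    2 * e * eV ^+ size st' * ((eV * pending_cost w1 + k%:R^-1 * Y) * prod_cost ws).
  move=> hv ht; rewrite unfold_avg /avg (bigID (fun i => `[< GR w i >])) /=.
  have hv2 : stack_valid (([set i | `[< GR w i >]]%SET, w) :: st').
    by split=> // i; rewrite inE => /asboolP.
  have := IH _ w1 hv2; rewrite /=; under eq_bigl do rewrite inE.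
  rewrite exprS; set a := k%:R^-1 * _ => ha.
  have hb : \sum_(i | ~~ `[< GR w i >]) stack_sum st' (mul w (mul (s i) w1)) (word_avg decay ws)
      <= 2 * e * eV ^+ size st' * (Y * prod_cost ws).
    apply: sum_few_le => [i j /asboolPn hi /asboolPn||i]; first exact: badR hi.
      by apply: mulr_ge0 => //; apply: mulr_ge0 => //; move: e2; lra.
    apply: le_trans (IH _ _ hv) _; apply: ler_wpM2l => //; apply: ler_wpM2r => //.
    by have /andP[] := pending_cost_le (mul w (mul (s i) w1)).
  rewrite -(ler_pM2l kV0) in hb; rewrite mulrDr -/a; move: (lerD ha hb).
  by move=> /le_trans; apply; rewrite le_eqVlt; apply/orP; left; apply/eqP; ring.
have hpw : pending_cost w = 1 by rewrite /pending_cost hw.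
rewrite hpw mul1r.
have fin := append_cost_long w1.
have kA0 : 0 <= k%:R^-1 * (e * append_cost w1).
  apply: mulr_ge0; first exact: ltW; apply: mulr_ge0; first exact: expR_ge0.
  by rewrite /append_cost; case: ifP => _; have := mulr_ge0 (ltW kV0) (expR_ge0 1); move: e2; lra.
case: st hst => [|[A v] st] hst.
  apply: le_trans (clean _ hst I) _; apply: ler_wpM2l => //; apply: ler_wpM2r => //; lra.
rewrite stack_sum_split; have [hv' ht] := stack_valid_sub w hst.
have h1 := clean _ hv' ht.
have hst' : stack_valid st by case: hst => _ [_ []].
have h2 : \sum_(i in A | ~~ `[< GL i w >]) stack_sum st (mul v (mul (s i) w)) (word_avg decay (w1 :: ws))
    <= 2 * e * eV ^+ size st * (append_cost w1 * prod_cost ws).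
  apply: bad_left_le => [|i]; last exact: dirty.
  apply: mulr_ge0 => //; apply: mulr_ge0 => //.
  by rewrite /append_cost; case: ifP => _; have := mulr_ge0 (ltW kV0) (expR_ge0 1); move: e2; lra.
rewrite -(ler_pM2l kV0) in h2.
apply: le_trans (lerD h1 h2) _.
have -> : k%:R^-1 * (2 * e * eV ^+ size st * (append_cost w1 * prod_cost ws)) =
  2 * e * eV ^+ (size st).+1 * (k%:R^-1 * (e * append_cost w1) * prod_cost ws).
  rewrite exprS; set a := k%:R^-1 * _; transitivity (eV * e * a); first by rewrite eVe mul1r.
  by rewrite /a; ring.
rewrite /= -mulrDr; apply: ler_wpM2l; first exact: (Ge0 ((A, v) :: st)).
by rewrite -mulrDl; apply: ler_wpM2r.
Qed.

End Pivot.

(** * Transition operators *)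

Section Avg.
Variables (R : realType) (k : nat).
Hypothesis k0 : (0 < k)%N.

Lemma avg_le (a b : 'I_k -> R) : (forall i, a i <= b i) -> avg a <= avg b.
Proof. by move=> h; apply: ler_wpM2l; [rewrite invr_ge0 | apply: ler_sum]. Qed.

Lemma avg_cst (c : R) : avg (fun _ : 'I_k => c) = c.
Proof.
by rewrite /avg sumr_const card_ord -(mulr_natl c) mulrA mulVf ?mul1r // pnatr_eq0 -lt0n.
Qed.

Lemma avg_lin (c : R) (a b : 'I_k -> R) :
  avg (fun i => c * a i + b i) = c * avg a + avg b.
Proof. by rewrite /avg big_split /= -mulr_sumr; ring. Qed.

End Avg.

Section RightOperators.
Variables (R : realType) (G : Type) (mul : G -> G -> G) (one : G).
Hypotheses (mulA : forall a b c, mul a (mul b c) = mul (mul a b) c)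
  (mulg1 : forall a, mul a one = a).

Definition bounded_fct (f : G -> R) : Prop := exists C, forall g, `|f g| <= C.

Lemma bounded_fct_cst c : bounded_fct (fun=> c). Proof. by exists `|c|. Qed.

Lemma bounded_lin c f g : bounded_fct f -> bounded_fct g ->
  bounded_fct (fun x => c * f x + g x).
Proof.
move=> [C hC] [C' hC']; exists (`|c| * C + C') => x; apply: le_trans (ler_normD _ _) _.
by rewrite normrM; apply: lerD => //; apply: ler_wpM2l.
Qed.

Lemma bounded_comp f (u : G -> G) : bounded_fct f -> bounded_fct (fun x => f (u x)).
Proof. by move=> [C hC]; exists C. Qed.

Lemma bounded_sum (I : Type) (r : seq I) (F : I -> G -> R) :
  (forall i, bounded_fct (F i)) -> bounded_fct (fun x => \sum_(i <- r) F i x).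
Proof.
move=> hF; elim: r => [|i r [C hC]].
  by under eq_fun do rewrite big_nil; exact: bounded_fct_cst.
have [C' hC'] := hF i; exists (C' + C) => x; rewrite big_cons.
by apply: le_trans (ler_normD _ _) _; apply: lerD.
Qed.

Variable Ep : (G -> R) -> R.
Hypotheses
  (Ep_lin : forall c f g, bounded_fct f -> bounded_fct g ->
     Ep (fun x => c * f x + g x) = c * Ep f + Ep g)
  (Ep_ge0 : forall f, bounded_fct f -> (forall x, 0 <= f x) -> 0 <= Ep f)
  (Ep_cst : forall c, Ep (fun=> c) = c).

Lemma Ep_le f g : bounded_fct f -> bounded_fct g -> (forall x, f x <= g x) -> Ep f <= Ep g.
Proof.
move=> bf bg h; rewrite -subr_ge0; have -> : Ep g - Ep f = -1 * Ep f + Ep g by ring.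
rewrite -Ep_lin //; apply: Ep_ge0; first exact: bounded_lin.
by move=> x; rewrite mulN1r addrC subr_ge0.
Qed.

Definition transition (f : G -> R) (x : G) : R := Ep (fun y => f (mul x y)).

Local Notation T := transition.

Lemma transition_bounded n f : bounded_fct f -> bounded_fct (iter n T f).
Proof.
move=> bf; elim: n => [//|n [C hC]] /=; exists C => x.
have b : bounded_fct (fun y => iter n T f (mul x y)) by exists C.
rewrite ler_norml; apply/andP; split.
  rewrite -(Ep_cst (- C)); apply: Ep_le => //; first exact: bounded_fct_cst.
  by move=> y; have := hC (mul x y); rewrite ler_norml => /andP[].
rewrite -(Ep_cst C); apply: Ep_le => //; first exact: bounded_fct_cst.
by move=> y; have := hC (mul x y); rewrite ler_norml => /andP[].
Qed.

Lemma transition_lin n c f g : bounded_fct f -> bounded_fct g ->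
  iter n T (fun x => c * f x + g x) = (fun x => c * iter n T f x + iter n T g x).
Proof.
move=> bf bg; elim: n => [//|n IH] /=; rewrite IH; apply/funext => x.
by rewrite /T Ep_lin //; apply: (bounded_comp (mul x)); apply: transition_bounded.
Qed.

Lemma transition_cst n c : iter n T (fun=> c) = (fun=> c).
Proof. by elim: n => [//|n IH] /=; rewrite IH; apply/funext => x; rewrite /T Ep_cst. Qed.

Lemma transition_le n f g : bounded_fct f -> bounded_fct g -> (forall x, f x <= g x) ->
  forall x, iter n T f x <= iter n T g x.
Proof.
move=> bf bg h; elim: n => [//|n IH] x /=.
by apply: Ep_le => //; apply: (bounded_comp (mul x)); apply: transition_bounded.
Qed.

Lemma transition_ge0 n f : bounded_fct f -> (forall x, 0 <= f x) ->
  forall x, 0 <= iter n T f x.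
Proof.
move=> bf h x; have := transition_le n (bounded_fct_cst 0) bf h x.
by rewrite transition_cst.
Qed.

Lemma transition_sum n (I : Type) (r : seq I) (F : I -> G -> R) :
  (forall i, bounded_fct (F i)) ->
  iter n T (fun x => \sum_(i <- r) F i x) = (fun x => \sum_(i <- r) iter n T (F i) x).
Proof.
move=> hF; elim: r => [|i r IH].
  under eq_fun do rewrite big_nil; rewrite transition_cst.
  by apply/funext => x; rewrite big_nil.
under eq_fun do rewrite big_cons -[F _ _]mul1r.
rewrite transition_lin //; last exact: bounded_sum.
by rewrite IH; apply/funext => x; rewrite big_cons mul1r.
Qed.

Lemma transition_shift n f a x :
  iter n T (fun y => f (mul a y)) x = iter n T f (mul a x).
Proof.
elim: n x => [//|n IH] x /=; rewrite /T; congr Ep; apply/funext => y.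
by rewrite IH mulA.
Qed.

Variables (k : nat) (s : 'I_k -> G).
Hypothesis k0 : (0 < k)%N.

Lemma bounded_avg (F : 'I_k -> G -> R) : (forall i, bounded_fct (F i)) ->
  bounded_fct (fun x => avg (fun i => F i x)).
Proof.
move=> hF; rewrite /avg.
under eq_fun => x do rewrite -[_ * _]addr0.
by apply: bounded_lin; [exact: bounded_sum | exact: bounded_fct_cst].
Qed.

Lemma transition_avg n (F : 'I_k -> G -> R) : (forall i, bounded_fct (F i)) ->
  iter n T (fun x => avg (fun i => F i x)) = (fun x => avg (fun i => iter n T (F i) x)).
Proof.
move=> hF; rewrite /avg; under eq_fun => x do rewrite -[_ * _]addr0.
rewrite transition_lin; [|exact: bounded_sum|exact: bounded_fct_cst].
by rewrite transition_cst transition_sum //; apply/funext => x; rewrite addr0.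
Qed.

(** The closed pieces are listed last first and [z] is the piece still open, on whose right the walk
    goes on. *)
Fixpoint prefix_avg (pre : seq G) (f : G -> R) (z : G) : R :=
  match pre with
  | [::] => f z
  | w :: pre' => avg (fun i => prefix_avg pre' f (mul w (mul (s i) z)))
  end.

Lemma prefix_avg_bounded pre f : bounded_fct f -> bounded_fct (prefix_avg pre f).
Proof.
move=> bf; elim: pre => [//|w pre IH] /=; apply: bounded_avg => i.
exact: (bounded_comp (fun z => mul w (mul (s i) z))).
Qed.

(** Walk steps multiply on the right and prefixes on the left, so the two operations commute. *)
Lemma transition_prefix n pre f : bounded_fct f ->
  iter n T (prefix_avg pre f) = prefix_avg pre (iter n T f).
Proof.
move=> bf; elim: pre => [//|w pre IH] /=; rewrite transition_avg; last first.
  move=> i; apply: (bounded_comp (fun z => mul w (mul (s i) z))).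
  exact: prefix_avg_bounded.
apply/funext => x; congr avg; apply/funext => i; rewrite mulA -IH -transition_shift.
by congr (iter _ T _ _); apply/funext => y; rewrite mulA.
Qed.

Lemma prefix_avg_avg pre (f : G -> R) (y : 'I_k -> G) w :
  prefix_avg pre (fun x => avg (fun i => f (mul x (y i)))) w =
  avg (fun i => prefix_avg pre f (mul w (y i))).
Proof.
elim: pre w => [//|v pre IH] w /=.
under [in LHS]eq_fun => i do rewrite IH.
rewrite /avg -mulr_sumr exchange_big /= mulr_sumr; congr (_ * _).
by apply: eq_bigr => i _; congr (_ * _); apply: eq_bigr => j _; rewrite -!mulA.
Qed.

Lemma prefix_avg_cons w pre f ws z : prefix_avg (w :: pre) (word_avg mul s f ws) z =
  prefix_avg pre (word_avg mul s f (z :: ws)) w.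
Proof. by rewrite /= prefix_avg_avg. Qed.

(** * Waiting for a letter of the family *)

Variables (alpha : R) (m : nat).
Hypotheses (alpha01 : 0 <= alpha <= 1)
  (minor : forall f, bounded_fct f -> (forall x, 0 <= f x) -> forall x,
     alpha * avg (fun i => f (mul x (s i))) <= iter m T f x).

(** Apply [minor] to the nonnegative function [a + g - f]: the part of the operator beyond
    [alpha * avg] is positive of mass [1 - alpha]. *)
Lemma minor_bound f g a x : bounded_fct f -> bounded_fct g -> (forall y, 0 <= g y) ->
  (forall y, f y <= a + g y) ->
  iter m T f x <= alpha * avg (fun i => f (mul x (s i))) + (1 - alpha) * a + iter m T g x.
Proof.
move=> bf bg g0 hfg; case/andP: alpha01 => a0 a1.
have bag : bounded_fct (fun y => 1 * g y + a) by apply: bounded_lin => //; exact: bounded_fct_cst.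
have b : bounded_fct (fun y => -1 * f y + (1 * g y + a)) by exact: bounded_lin.
have := minor b; rewrite transition_lin // transition_lin //; last exact: bounded_fct_cst.
rewrite transition_cst => /(_ _ x).
rewrite avg_lin avg_lin avg_cst // => h.
have {}h : alpha * (-1 * avg (fun i : 'I_k => f (mul x (s i))) +
     (1 * avg (fun i : 'I_k => g (mul x (s i))) + a)) <=
   -1 * iter m T f x + (1 * iter m T g x + a).
  by apply: h => y; have := hfg y; lra.
have : 0 <= alpha * avg (fun i : 'I_k => g (mul x (s i))).
  by apply: mulr_ge0 => //; rewrite -(avg_cst k0 0); apply: avg_le.
lra.
Qed.

(* One waits for a letter of the family during at most [J] attempts of [m] steps; [U] is paid
   when all of them fail. *)
Lemma minor_iter f sh X0 Y0 U J x : bounded_fct f -> bounded_fct sh ->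
  (forall y, 0 <= sh y) -> 0 <= Y0 -> (forall y, f y <= U) -> 0 <= U -> 0 <= X0 ->
  (forall i w, avg (fun j => iter (m * i) T f (mul w (s j))) <= X0 + Y0 * sh w) ->
  iter (m * J) T f x <=
    X0 + (1 - alpha) ^+ J * U + alpha * Y0 * \sum_(j < J) iter (m * j) T sh x.
Proof.
move=> bf bsh sh0 Y00 hU U0 X00 hX; case/andP: alpha01 => a0 a1.
elim: J x => [|J IH] x.
  by rewrite muln0 big_ord0 mulr0 addr0 expr0 mul1r /=; have := hU x; lra.
have bsum : bounded_fct (fun y => \sum_(j < J) iter (m * j) T sh y).
  by apply: bounded_sum => j; exact: transition_bounded.
have bg : bounded_fct (fun y => alpha * Y0 * (\sum_(j < J) iter (m * j) T sh y) + 0).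
  by apply: bounded_lin => //; exact: bounded_fct_cst.
rewrite mulnS iterD.
have := @minor_bound (iter (m * J) T f) _ (X0 + (1 - alpha) ^+ J * U) x
  (transition_bounded (m * J) bf) bg.
rewrite transition_lin //; last exact: bounded_fct_cst.
rewrite transition_cst transition_sum; last by move=> j; exact: transition_bounded.
move=> h; apply: le_trans (h _ _) _.
- move=> y; rewrite addr0; apply: mulr_ge0; first exact: mulr_ge0.
  by apply: sumr_ge0 => j _; apply: transition_ge0.
- by move=> y; rewrite addr0; exact: IH.
rewrite big_ord_recl muln0 /= exprS.
have -> : \sum_(i < J) iter (m * bump 0 i) T sh x = \sum_(i < J) iter m T (iter (m * i) T sh) x.
  by apply: eq_bigr => i _; rewrite /bump /= add1n mulnS iterD.
have := ler_wpM2l a0 (hX J x); lra.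
Qed.

Variables (cost : G -> R) (sh : G -> R) (xc yc eta C1 Z Y3 : R) (N J : nat).
Hypotheses (cost0 : forall w, 0 <= cost w)
  (bsh : bounded_fct sh) (sh0 : forall w, 0 <= sh w)
  (xc0 : 0 <= xc) (yc0 : 0 <= yc) (cost_le : forall w, cost w <= xc + yc * sh w)
  (cost_le' : forall w, cost w <= yc) (C10 : 0 <= C1) (Z0 : 0 <= Z) (Y31 : 1 <= Y3)
  (sh_eta : forall n, (N <= n)%N -> iter n T sh one <= eta)
  (dirtyZ : yc + (1 - alpha) ^+ J * Y3 <= Z * Y3)
  (cleanZ : xc + (1 - alpha) ^+ J * Y3 + alpha * yc * (J%:R * eta) <= Z).

(* The second bound is the sharp one, but it needs at least [N] free steps after the last letter
   of the family; the first one, lossy by [Y3], is used when the [J] attempts fail. *)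
Lemma block_decay (h0 : G -> R) q : bounded_fct h0 ->
  (forall pre z, prefix_avg pre h0 z <= C1 * \prod_(w <- pre) cost w) ->
  (forall pre z, prefix_avg pre (iter (q * (m * J + N)) T h0) z <=
     C1 * (\prod_(w <- pre) cost w) * Z ^+ q * Y3) /\
  (forall pre n, (N <= n)%N -> iter n T (prefix_avg pre (iter (q * (m * J + N)) T h0)) one <=
     C1 * (\prod_(w <- pre) cost w) * Z ^+ q).
Proof.
move=> bh0 hh0; case/andP: alpha01 => a0 a1.
have P0 pre : 0 <= C1 * \prod_(w <- pre) cost w.
  by apply: mulr_ge0 => //; apply: prodr_ge0 => w _.
have b1J : 0 <= (1 - alpha) ^+ J by apply: exprn_ge0; lra.
elim: q => [|q [IHd IHc]].
  rewrite mul0n /=; split=> [pre z|pre n hn].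
    by rewrite expr0 mulr1; apply: le_trans (hh0 pre z) _; apply: ler_peMr.
  rewrite expr0 mulr1.
  have := transition_le n (prefix_avg_bounded pre bh0) (bounded_fct_cst _) (hh0 pre) one.
  by rewrite transition_cst.
set u := iter (q * (m * J + N)) T h0 in IHd IHc.
have bu : bounded_fct u by exact: transition_bounded.
pose f pre := iter N T (prefix_avg pre u).
have bp pre : bounded_fct (prefix_avg pre u) by exact: prefix_avg_bounded.
have bf pre : bounded_fct (f pre) by exact: transition_bounded.
pose D pre := C1 * (\prod_(w <- pre) cost w) * Z ^+ q.
have D0 pre : 0 <= D pre by apply: mulr_ge0 => //; exact: exprn_ge0.
have DE w pre : D (w :: pre) = D pre * cost w by rewrite /D big_cons; ring.
have hf pre : prefix_avg pre (iter (q.+1 * (m * J + N)) T h0) = iter (m * J) T (f pre).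
  rewrite /f transition_prefix // transition_prefix; last exact: transition_bounded.
  by rewrite mulSn !iterD.
have fU pre y : f pre y <= D pre * Y3.
  have := transition_le N (bp pre) (bounded_fct_cst _) (IHd pre) y.
  by rewrite transition_cst.
have U0 pre : 0 <= D pre * Y3 by apply: mulr_ge0 => //; exact: le_trans ler01 Y31.
have hX pre i w : avg (fun j => iter (m * i) T (f pre) (mul w (s j))) <= D pre * cost w.
  rewrite -DE; apply: le_trans (IHc (w :: pre) (m * i + N)%N _); last exact: leq_addl.
  rewrite /= transition_avg; last first.
    by move=> j; apply: (bounded_comp (fun z => mul w (mul (s j) z))).
  rewrite le_eqVlt; apply/orP; left; apply/eqP; congr avg; apply/funext => j.
  rewrite /f -iterD -{1}(mulg1 (mul w (s j))) -transition_shift.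
  by congr (iter _ T _ _); apply/funext => y; rewrite mulA.
split=> [pre z|pre n hn].
  rewrite hf; have h := @minor_iter (f pre) sh (D pre * yc) 0 (D pre * Y3) J z.
  apply: le_trans (h _ _ _ _ _ _ _ _) _ => //; first exact: mulr_ge0.
    move=> i w; rewrite mul0r addr0; apply: le_trans (hX pre i w) _.
    exact: ler_wpM2l.
  rewrite mulr0 mul0r addr0 exprSr.
  have := ler_wpM2l (D0 pre) dirtyZ; rewrite -/(D pre) {2}/D; rewrite /D; lra.
rewrite hf; have h z := @minor_iter (f pre) sh (D pre * xc) (D pre * yc) (D pre * Y3) J z.
have {}h z : iter (m * J) T (f pre) z <= D pre * xc + (1 - alpha) ^+ J * (D pre * Y3)
   + alpha * (D pre * yc) * \sum_(j < J) iter (m * j) T sh z.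
  apply: h => //; try exact: mulr_ge0.
  move=> i w; apply: le_trans (hX pre i w) _.
  by have := ler_wpM2l (D0 pre) (cost_le w); rewrite mulrDr mulrA.
have bsum : bounded_fct (fun y => \sum_(j < J) iter (m * j) T sh y).
  by apply: bounded_sum => j; exact: transition_bounded.
set a1' := D pre * xc + _ in h; set a2 := alpha * _ in h.
have := transition_le n (transition_bounded (m * J) (bf pre))
  (bounded_lin a2 bsum (bounded_fct_cst a1')) (fun z => _) one.
move=> h2; apply: le_trans (h2 _) _; first by move=> z; rewrite addrC; apply: h.
rewrite transition_lin //; last exact: bounded_fct_cst.
rewrite transition_cst transition_sum; last by move=> j; exact: transition_bounded.
(* At the j-th attempt the open piece has made n + m j free steps from [one], so it is rarely
   short. *)
have hs : \sum_(j < J) iter n T (iter (m * j) T sh) one <= J%:R * eta.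
  have -> : J%:R * eta = \sum_(j < J) eta by rewrite sumr_const card_ord mulr_natl.
  apply: ler_sum => j _; rewrite -iterD; apply: sh_eta.
  exact: leq_trans hn (leq_addr _ _).
have a20 : 0 <= a2 by apply: mulr_ge0 => //; exact: mulr_ge0.
have := ler_wpM2l a20 hs; rewrite exprSr; have := ler_wpM2l (D0 pre) cleanZ.
rewrite /a1' /a2 -/(D pre) {3}/D; rewrite /D; lra.
Qed.

End RightOperators.

(** * The law of the walk *)

Section IidWalk.
Variables (R : realType) (G : countType) (mul : G -> G -> G) (one : G).
Hypotheses (mulA : forall a b c, mul a (mul b c) = mul (mul a b) c)
  (mul1g : forall a, mul one a = a) (mulg1 : forall a, mul a one = a).
Variables (dT : measure_display) (T : measurableType dT) (P : probability T R)
  (p : G -> R) (gs : nat -> T -> G).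
Hypotheses (p0 : forall g, 0 <= p g) (iid : iid_law P p gs).

Definition step_mean (f : G -> R) : R := \int[P]_(w in setT) f (gs 0 w).

Lemma measurable_step i (f : G -> R) : measurable_fun setT (fun w => f (gs i w)).
Proof. by move=> _ Y _; rewrite setTI; exact: (iid.1 i (f @^-1` Y)). Qed.

Lemma integrable_step i (f : G -> R) (D : set T) : measurable D -> bounded_fct f ->
  P.-integrable D (EFin \o (fun w => f (gs i w))).
Proof.
move=> mD [C hC]; apply: measurable_bounded_integrable => //.
- by rewrite (le_lt_trans (probability_le1 _ mD)) ?ltry.
- exact: measurable_funS (measurable_step i f).
- by exists C; split; [exact: num_real | move=> M CM w _ /=; exact: le_trans (hC _) (ltW CM)].
Qed.

Lemma step_mean_lin c f g : bounded_fct f -> bounded_fct g ->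
  step_mean (fun x => c * f x + g x) = c * step_mean f + step_mean g.
Proof.
move=> bf bg; have b : bounded_fct (fun x => c * f x).
  by case: bf => C hC; exists (`|c| * C) => x; rewrite normrM ler_wpM2l.
rewrite /step_mean (RintegralD _ (integrable_step 0 _ b) (integrable_step 0 _ bg)) //.
by rewrite RintegralZl //; exact: integrable_step.
Qed.

Lemma step_mean_ge0 f : bounded_fct f -> (forall x, 0 <= f x) -> 0 <= step_mean f.
Proof. by move=> _ h; apply: Rintegral_ge0 => w _; exact: h. Qed.

Lemma step_mean_cst c : step_mean (fun=> c) = c.
Proof. by rewrite /step_mean Rintegral_cst // [X in fine X]probability_setT mulr1. Qed.

Local Notation tr := (transition mul step_mean).

Definition cylinder m (A : nat -> set G) : set T := \bigcap_(i in `I_m) (gs i @^-1` A i).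

Lemma measurable_cylinder m A : measurable (cylinder m A).
Proof.
by apply: bigcap_measurableType => // i _; exact: iid.1.
Qed.

Definition extend m (A : nat -> set G) h : nat -> set G :=
  fun i => if i == m then [set h] else A i.

Lemma cylinder_extend m A h :
  cylinder m A `&` gs m @^-1` [set h] = cylinder m.+1 (extend m A h).
Proof.
apply/seteqP; split=> w.
  move=> [hA hm] i /=; rewrite ltnS leq_eqVlt /extend => /orP[/eqP ->|im].
    by rewrite eqxx.
  by rewrite ltn_eqF //; exact: hA.
move=> hA; split; last by have := hA m (ltnSn m); rewrite /extend /= eqxx.
by move=> i /= im; have := hA i (ltnW im : (i < m.+1)%N); rewrite /extend /= ltn_eqF.
Qed.

Lemma cylinder_step m A h :
  P (cylinder m A `&` gs m @^-1` [set h]) = (P (cylinder m A) * (p h)%:E)%E.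
Proof.
rewrite cylinder_extend /cylinder !iid.2 big_ord_recr /= /extend eqxx; congr (_ * _)%E.
  by apply: eq_bigr => i _; rewrite ltn_eqF.
by rewrite /mass esum_set1 // lee_fin.
Qed.

Lemma step_law h : P (gs 0 @^-1` [set h]) = (p h)%:E.
Proof.
have := cylinder_step 0 (fun=> setT) h.
have -> : cylinder 0 (fun=> setT) = setT by apply/seteqP; split=> // w _ i.
by rewrite setTI probability_setT mul1e.
Qed.

Lemma step_mean_minor h f : bounded_fct f -> (forall x, 0 <= f x) -> p h * f h <= step_mean f.
Proof.
move=> bf f0; have mh : measurable (gs 0 @^-1` [set h]) by exact: iid.1.
rewrite -lee_fin /step_mean /Rintegral fineK; last first.
  by apply: integrable_fin_num => //; exact: integrable_step.
apply: (@le_trans _ _ (\int[P]_(w in gs 0 @^-1` [set h]) (f (gs 0 w))%:E)%E); last first.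
  apply: ge0_subset_integral => //; last by move=> w _; rewrite lee_fin.
  by apply/measurable_realfun.measurable_EFinP; exact: measurable_step.
rewrite (eq_integral (cst (f h)%:E)); last by move=> w; rewrite inE => /= ->.
by rewrite integral_cst // [X in (_ * X)%E]step_law -EFinM mulrC.
Qed.

(** Recursion on the first step, as for the transition operator; the shift [m] allows conditioning
    on the earlier steps. *)
Fixpoint walk_from (m n : nat) (w : T) : G :=
  match n with
  | 0 => one
  | n'.+1 => mul (gs m w) (walk_from m.+1 n' w)
  end.

Lemma walk_fromS m n w : walk_from m n.+1 w = mul (walk_from m n w) (gs (m + n) w).
Proof.
elim: n m => [|n IH] m /=; first by rewrite addn0 mul1g mulg1.
by rewrite -mulA addnS -addSn -IH.
Qed.

Lemma walkE n w : walk mul one gs n w = walk_from 0 n w.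
Proof. by elim: n => [//|n IH]; rewrite walk_fromS /= IH. Qed.

Lemma measurable_walk_from m n (A : set G) : measurable (walk_from m n @^-1` A).
Proof.
elim: n m A => [|n IH] m A.
  have [h|h] := pselect (A one).
    rewrite (_ : _ @^-1` _ = setT) //; by apply/seteqP; split.
  by rewrite (_ : _ @^-1` _ = set0) //; apply/seteqP; split.
rewrite (_ : _ @^-1` _ = \bigcup_(h in [set: G])
   (gs m @^-1` [set h] `&` walk_from m.+1 n @^-1` [set x | A (mul h x)])).
  apply: countable_bigcupT_measurable => [|h]; first exact: countableP.
  by apply: measurableI; [exact: iid.1 | exact: IH].
apply/seteqP; split=> [w hw|w [h _ [/= -> //]]].
by exists (gs m w).
Qed.

Definition indicator (A : set G) (x : G) : R := (`[< A x >])%:R.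

Lemma indicator_bounded A : bounded_fct (indicator A).
Proof. by exists 1 => x; rewrite /indicator; case: asboolP => _; rewrite ?normr1 ?normr0. Qed.

Lemma measure_step_decomp m (D : set T) : measurable D ->
  P D = (\sum_(k <oo) (if pickle_inv k is Some h then P (D `&` gs m @^-1` [set h]) else 0))%E.
Proof.
move=> mD; pose F k := D `&` gs m @^-1` [set h | pickle h = k].
have mF k : measurable (F k) by apply: measurableI => //; exact: iid.1.
rewrite [in LHS](_ : D = \bigcup_k F k); last first.
  by apply/seteqP; split=> [w Dw|w [k _ []//]]; exists (pickle (gs m w)).
rewrite measure_semi_bigcup //; last first.
- exact: bigcup_measurable.
- by move=> i j _ _ [w [[_ /= <-] [_ /= <-]]].
apply: eq_eseriesr => k _.
case E : (pickle_inv k) => [h|].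
  have hk : pickle h = k by have := @pickle_invK G k; rewrite E.
  congr (P _); apply/seteqP; split=> w [Dw /= hw].
    by split => //=; apply: (pcan_inj (@pickleK_inv G)); rewrite hw hk.
  by split=> /=; rewrite ?hw.
rewrite -(measure0 P); congr (P _); apply/seteqP; split=> // w [_ /= hw].
by have := pickleK_inv (gs m w); rewrite hw E.
Qed.

Lemma step_mean_series f : bounded_fct f -> (forall x, 0 <= f x) ->
  (step_mean f)%:E = (\sum_(k <oo) (if pickle_inv k is Some h then (p h * f h)%R%:E else 0))%E.
Proof.
move=> bf f0; rewrite /step_mean /Rintegral fineK; last first.
  by apply: integrable_fin_num => //; exact: integrable_step.
pose F k := gs 0 @^-1` [set h | pickle h = k].
have mF k : measurable (F k) by exact: iid.1.
have -> : [set: T] = \bigcup_k F k.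
  by apply/seteqP; split=> [w _|//]; exists (pickle (gs 0 w)).
rewrite ge0_integral_bigcup //; last 3 first.
- apply/measurable_realfun.measurable_EFinP; apply: measurable_funS (measurable_step 0 f) => //.
- by move=> w _; rewrite lee_fin.
- by move=> i j _ _ [w [/= <- /= <-]].
apply: eq_eseriesr => k _.
case E : (pickle_inv k) => [h|].
  have hk : pickle h = k by have := @pickle_invK G k; rewrite E.
  have hF : F k = gs 0 @^-1` [set h].
    apply/seteqP; split=> w /= hw; last by rewrite /F /= hw.
    by apply: (pcan_inj (@pickleK_inv G)); rewrite hw hk.
  rewrite (eq_integral (cst (f h)%:E)); last by move=> w; rewrite hF inE => /= ->.
  by rewrite integral_cst // hF [X in (_ * X)%E]step_law -EFinM mulrC.
rewrite (_ : F k = set0) ?integral_set0 //; apply/seteqP; split=> // w /= hw.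
by have := pickleK_inv (gs 0 w); rewrite hw E.
Qed.

(** Independence is known on cylinders only, so the induction carries one: conditioning on the value
    of step [m] extends the cylinder by one coordinate. *)
Lemma cylinder_walk m n A (Q : set G) :
  P (cylinder m A `&` walk_from m n @^-1` Q) =
  (P (cylinder m A) * (iter n tr (indicator Q) one)%:E)%E.
Proof.
elim: n m A Q => [|n IH] m A Q.
  rewrite /= /indicator; case: asboolP => h.
    by rewrite mule1; congr (P _); apply/seteqP; split=> [w []//|w hw].
  by rewrite mule0 -(measure0 P); congr (P _); apply/seteqP; split=> // w [].
have bT f : bounded_fct f -> bounded_fct (iter n tr f).
  exact: (transition_bounded mul step_mean_lin step_mean_ge0 step_mean_cst).
have T0 : forall x, 0 <= iter n tr (indicator Q) x.
  apply: (transition_ge0 mul step_mean_lin step_mean_ge0 step_mean_cst); last by move=> x; exact: ler0n.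
  exact: indicator_bounded.
rewrite (measure_step_decomp m); last first.
  by apply: measurableI; [exact: measurable_cylinder | exact: measurable_walk_from].
have -> : iter n.+1 tr (indicator Q) one = step_mean (iter n tr (indicator Q)).
  by rewrite /= /transition; congr step_mean; apply/funext => y; rewrite mul1g.
rewrite step_mean_series //; last by apply: bT; exact: indicator_bounded.
have fc : P (cylinder m A) \is a fin_num by apply: fin_num_measure; exact: measurable_cylinder.
rewrite -(fineK fc) -nneseriesZl; last first.
  by move=> k _; case: pickle_inv => // h; rewrite lee_fin mulr_ge0.
apply: eq_eseriesr => k _; case: pickle_inv => [h|]; last by rewrite mule0.
rewrite fineK // EFinM muleA -cylinder_step.
have -> : iter n tr (indicator Q) h = iter n tr (indicator [set x | Q (mul h x)]) one.
  by rewrite -[h in LHS]mulg1 -(transition_shift mulA).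
rewrite cylinder_extend -IH -cylinder_extend.
congr (P _); apply/seteqP; split=> w /=.
  by move=> [[hA hQ] hm]; split=> //; rewrite -hm.
by move=> [[hA hm] hQ]; split=> //; split=> //; rewrite hm.
Qed.

Lemma walk_law n (Q : set G) :
  P [set w | Q (walk mul one gs n w)] = (iter n tr (indicator Q) one)%:E.
Proof.
have := cylinder_walk 0 n (fun=> setT) Q.
have -> : cylinder 0 (fun=> setT) = setT by apply/seteqP; split=> // w _ i.
rewrite setTI probability_setT mul1e => <-; congr (P _).
by apply/seteqP; split=> w /=; rewrite walkE.
Qed.

Lemma transition_minor_word (l : seq G) f x : bounded_fct f -> (forall y, 0 <= f y) ->
  (\prod_(h <- l) p h) * f (mul x (word_prod mul one l)) <= iter (size l) tr f x.
Proof.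
move=> bf f0; elim: l x => [|h l IH] x; first by rewrite big_nil mul1r /= mulg1.
have bT n : bounded_fct (iter n tr f).
  exact: (transition_bounded mul step_mean_lin step_mean_ge0 step_mean_cst).
have T0 n : forall x, 0 <= iter n tr f x.
  exact: (transition_ge0 mul step_mean_lin step_mean_ge0 step_mean_cst).
rewrite big_cons /= -mulrA; apply: le_trans (step_mean_minor h _ _) => //; last first.
  by apply: (bounded_comp (mul x)).
by apply: ler_wpM2l => //; rewrite mulA; exact: IH.
Qed.

(** Almost sure convergence makes it negligible that the ratio falls below [L] infinitely often;
    continuity from above turns this into a bound at each large n. *)
Lemma walk_eventually (F : G -> R) (lam : \bar R) (L : R) : (L%:E < lam)%E ->
  {ae P, forall w, (fun n : nat => (F (walk mul one gs n w) / n%:R)%:E) @ \oo --> lam} ->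
  forall eta, 0 < eta -> exists N : nat, forall n : nat, (N <= n)%N ->
    iter n tr (indicator [set x | F x < L * n%:R]) one <= eta.
Proof.
move=> Llam hae eta eta0.
pose E n : set T := [set w | F (walk mul one gs n w) < L * n%:R].
have mE n : measurable (E n).
  have := measurable_walk_from 0 n [set x | F x < L * n%:R]; congr measurable.
  by apply/seteqP; split=> w; rewrite /E /= walkE.
pose U m := \bigcup_(n in [set n | (m <= n)%N]) E n.
have mU m : measurable (U m) by apply: bigcup_measurable => n _.
have mI : measurable (\bigcap_m U m) by apply: bigcapT_measurable.
have hU : P (\bigcap_m U m) = 0%E.
  apply: measure_negligible => //.
  apply: negligibleS hae => w hw /= hcv.
  have := hcv _ (open_nbhs_nbhs (conj (@open_ereal_gt_ereal R L%:E) Llam)).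
  (* The successor ensures n > 0, as needed for the quotient by n. *)
  move=> [N _ hN]; have [n /= Nn hE] := hw N.+1 I.
  have := hN n (ltnW Nn); rewrite /= lte_fin ltNge => /negP; apply.
  have n0 : 0 < n%:R :> R by rewrite ltr0n (leq_trans _ Nn).
  by rewrite ler_pdivrMr // ltW.
have hc : P \o U @ \oo --> 0%E.
  rewrite -hU; apply: nonincreasing_cvg_mu => //.
    by rewrite (le_lt_trans (probability_le1 _ (mU 0))) ?ltry.
  move=> m n mn; apply/subsetPset => w [k /= nk Ek]; exists k => //=.
  exact: leq_trans nk.
have [N _ hN] : \forall n \near \oo, (P (U n) < eta%:E)%E.
  by apply: (hc [set x | (x < eta%:E)%E]); apply: open_nbhs_nbhs; split;
    [exact: open_ereal_lt_ereal | rewrite /= lte_fin].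
exists N => n Nn; rewrite -lee_fin -walk_law.
apply: le_trans (ltW (hN n Nn)); apply: le_measure; rewrite ?inE //.
- exact: (mE n).
- by move=> w hw; exists n => /=.
Qed.

End IidWalk.

(** * Large deviations *)

Lemma small_power (R : realType) (z c : R) : 0 <= z < 1 -> 0 < c ->
  exists J : nat, z ^+ J <= c.
Proof.
move=> /andP[z0 z1] c0; have hz : `|z| < 1 by rewrite ger0_norm.
have [J _ hJ] : \forall n \near \oo, `|0 - z ^+ n| < c.
  by move/cvgrPdist_lt: (cvg_expr hz); apply.
exists J; have := hJ J (leqnn J); rewrite /= sub0r normrN => /ltW.
by rewrite ger0_norm // exprn_ge0.
Qed.

Lemma large_natr (R : realType) (a b : R) : 0 < a -> exists N : nat, forall n : nat,
  (N <= n)%N -> b < a * n%:R.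
Proof.
move=> a0; exists (Num.bound (`|b| / a)) => n hn.
have h : 0 <= `|b| / a by apply: divr_ge0 => //; exact: ltW.
have := archi_boundP h; rewrite ltr_pdivrMr // => h1.
apply: le_lt_trans (ler_norm b) _; apply: lt_le_trans h1 _.
by rewrite mulrC ler_pM2l // ler_nat.
Qed.

Lemma exponent_gap (R : realType) (b n q : nat) (L B' del : R) :
  (n < q.+1 * b)%N -> (0 < b)%N -> 0 <= del <= 1 ->
  L * n%:R / B' - (1 - del) * q%:R <= 1 - ((1 - del) / b%:R - L / B') * n%:R.
Proof.
move=> hn b0 /andP[d0 d1]; have b0' : 0 < b%:R :> R by rewrite ltr0n.
have : n%:R / b%:R <= q.+1%:R :> R.
  by rewrite ler_pdivrMr // -natrM ler_nat ltnW.
rewrite -natr1 => h; have d1' : 0 <= 1 - del by lra.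
have := ler_wpM2l d1' h; rewrite mulrDr mulr1.
have -> : ((1 - del) / b%:R - L / B') * n%:R = (1 - del) * (n%:R / b%:R) - L * n%:R / B' by ring.
lra.
Qed.

Section LargeDeviation.
Variables (R : realType) (G : Type) (mul : G -> G -> G) (one : G).
Hypotheses (mulA : forall a b c, mul a (mul b c) = mul (mul a b) c)
  (mul1g : forall a, mul one a = a) (mulg1 : forall a, mul a one = a).
Variable Ep : (G -> R) -> R.
Hypotheses
  (Ep_lin : forall c f g, bounded_fct f -> bounded_fct g ->
     Ep (fun x => c * f x + g x) = c * Ep f + Ep g)
  (Ep_ge0 : forall f, bounded_fct f -> (forall x, 0 <= f x) -> 0 <= Ep f)
  (Ep_cst : forall c, Ep (fun=> c) = c).
Variables (len : G -> R) (k m : nat) (s : 'I_k -> G).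
Variables (GR GR2 : G -> 'I_k -> Prop) (GL : 'I_k -> G -> Prop) (E : R).
Hypotheses (len0 : forall w, 0 <= len w) (E0 : 0 <= E)
  (badR : forall w i j, ~ GR w i -> ~ GR w j -> i = j)
  (badL : forall w i j, ~ GL i w -> ~ GL j w -> i = j)
  (GRW : forall w i, GR w i -> GR2 w i)
  (GRL_len : forall v i w, GR2 v i -> GL i w ->
     len v + len w - E <= len (mul v (mul (s i) w)))
  (GRL_step : forall v i w j, GR2 v i -> GL i w -> E <= len w -> GR w j ->
     GR2 (mul v (mul (s i) w)) j).

Local Notation e := (expR 1 : R).
Local Notation eV := (expR (- 1) : R).
Local Notation T := (transition mul Ep).
Hypothesis ke : 4 * e <= k%:R.

Let e2 : 2 <= e. Proof. by apply: le_trans (expR_ge1Dx _); lra. Qed.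
Let eVe : eV * e = 1. Proof. by rewrite -expRD addNr expR0. Qed.
Let eV0 : 0 < eV. Proof. exact: expR_gt0. Qed.
Let k0 : 0 < k%:R :> R. Proof. by move: ke e2; lra. Qed.
Let ek0 : 0 < e / k%:R. Proof. by apply: divr_gt0 => //; exact: expR_gt0. Qed.
Let ek : 4 * (e / k%:R) <= 1. Proof. by rewrite mulrA ler_pdivrMr // mul1r. Qed.
Let eV1 : eV <= 2^-1.
Proof.
have : 0 <= eV * (e - 2) by rewrite mulr_ge0 ?(ltW eV0) // subr_ge0.
by rewrite mulrBr eVe; lra.
Qed.
Let Y4 : 16 <= (2 * e) ^+ 2.
Proof. by have : 4 <= 2 * e by [move: e2; lra]; rewrite expr2 => h; nra. Qed.

(** Start with an empty stack. The first piece, weighed by [pending_cost], is rewritten in terms of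
    [step_cost] at the price of a factor e, so that all pieces are treated alike. *)
Lemma prefix_word_bound B pre ws z : 2 * E < B ->
  prefix_avg mul s pre (word_avg mul s (decay len E B) ws) z <=
  2 * e * e * (prod_cost len k E B pre * (step_cost len k E B z * prod_cost len k E B ws)).
Proof.
move=> EB; elim: pre ws z => [|w pre IH] ws z.
  have := pivot_bound mulA mul1g len0 E0 badR badL GRW GRL_len GRL_step EB ke ws (st := [::]) z I.
  rewrite /prefix_avg /= expr0 mulr1 => h; apply: le_trans h _.
  rewrite {2}/prod_cost big_nil mul1r -[leRHS]mulrA; apply: ler_wpM2l; first by move: e2; lra.
  rewrite [leRHS]mulrA; apply: ler_wpM2r; first exact: prod_cost_ge0.
  rewrite /pending_cost /step_cost; case: (ifP (B + E <= len z)) => h.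
    rewrite ifT; last by move: E0 h; lra.
    by have : 0 <= e * (e / k%:R) by [apply: mulr_ge0; [exact: expR_ge0 | exact: ltW]];
       rewrite mulrDr [e * eV]mulrC eVe -[4 * e / _]mulrA; lra.
  have h1 : 1 <= 2 * e by move: e2; lra.
  by case: ifP => _; move: e2 Y4; rewrite ?expr2; nra.
rewrite prefix_avg_cons //; apply: le_trans (IH _ _) _.
by rewrite /prod_cost !big_cons le_eqVlt; apply/orP; left; apply/eqP; ring.
Qed.

Variables (alpha L L' : R).
Hypotheses (alpha01 : 0 < alpha <= 1)
  (minor : forall f, bounded_fct f -> (forall x, 0 <= f x) -> forall x,
     alpha * avg (fun i => f (mul x (s i))) <= iter m T f x)
  (L0 : 0 < L) (LL' : L < L') (kL : 16 * e ^+ 2 * L' < k%:R * (L' - L)).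

Local Notation ind Q := (fun x : G => (`[< Q x >])%:R : R).

Hypothesis typical : forall eta : R, 0 < eta -> exists N : nat, forall n : nat,
  (N <= n)%N -> iter n T (ind (fun x => len x < L' * n%:R)) one <= eta.

Let ind_bounded (Q : G -> Prop) : bounded_fct (ind Q).
Proof. by exists 1 => x; case: asboolP => _; rewrite ?normr1 ?normr0. Qed.

Lemma large_deviation : exists K : R, 0 < K /\ forall n : nat,
  iter n T (ind (fun x => len x <= L * n%:R)) one <= K * expR (- (n%:R / K)).
Proof.
case/andP: alpha01 => a0 a1; have Lpos := L0; have LltL' := LL'; have Epos := E0.
have L'0 : 0 < L' by lra.
have k0n : (0 < k)%N by move: k0; rewrite ltr0n.
(* Chosen so that [Z = eV * (1 + del)]; the assumption [kL] says that [del * L'] is less than half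
   of [L' - L]. *)
pose del : R := 8 * e * (e / k%:R).
have del0 : 0 <= del.
  by apply: mulr_ge0; [move: e2; lra | exact: ltW].
have hdel : 2 * del * L' < L' - L.
  rewrite -(ltr_pM2l k0) /del.
  have -> : k%:R * (2 * (8 * e * (e / k%:R)) * L') = (k%:R / k%:R) * (16 * e ^+ 2 * L') by ring.
  by rewrite divff ?gt_eqF // mul1r.
have del1 : del <= 1.
  by rewrite -(ler_pM2r L'0); lra.
pose xc : R := eV + 4 * e / k%:R.
pose yc : R := (2 * e) ^+ 2.
(* Then [eV * Y3 = 2 * yc], which leaves room for [yc] and the failure term in [dirtyZ]. *)
pose Y3 : R := 2 * e * yc.
(* The 8 is 4 from [xc], 2 for the failure of all J attempts, and 2 for blocks shorter than
   expected. *)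
pose Z : R := eV + 8 * (e / k%:R).
have yc0 : 0 < yc by rewrite /yc; move: Y4; lra.
have Y30 : 0 < Y3 by apply: mulr_gt0 => //; move: e2; lra.
have [J hJ] : exists J : nat, (1 - alpha) ^+ J <= 2 * (e / k%:R) / Y3.
  by apply: small_power; [lra | apply: divr_gt0 => //; move: ek0; lra].
have {}hJ : (1 - alpha) ^+ J * Y3 <= 2 * (e / k%:R) by rewrite -ler_pdivlMr.
pose eta : R := 2 * (e / k%:R) / (yc * J.+1%:R).
have ycJ : 0 < yc * J.+1%:R by apply: mulr_gt0 => //; rewrite ltr0n.
have eta0 : 0 < eta by apply: divr_gt0 => //; move: ek0; lra.
have [N1 hN1] := typical eta0.
(* Half of [L' - L] covers the loss due to [del]; the other half absorbs the junction losses and the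
   waiting time. *)
have [N2 hN2] := @large_natr R ((L' - L) / 2) (5 * E + L * (m * J)%:R) ltac:(lra).
pose N := maxn 1 (maxn N1 N2).
have N0 : (0 < N)%N by rewrite /N leq_max.
have {}hN2 : 5 * E + L * (m * J)%:R < (L' - L) / 2 * N%:R.
  by apply: hN2; rewrite /N !leq_max leqnn !orbT.
have {}hN1 n : (N <= n)%N -> iter n T (ind (fun x => len x < L' * n%:R)) one <= eta.
  by move=> hn; apply: hN1; apply: leq_trans hn; rewrite /N !leq_max leqnn !orbT.
have N0' : 0 < N%:R :> R by rewrite ltr0n.
have mJ0 : 0 <= L * (m * J)%:R by apply: mulr_ge0 => //; exact: ltW.
pose B := L' * N%:R - E.
have hB : 5 * E < L' * N%:R.
  have : (L' - L) / 2 * N%:R <= L' * N%:R by rewrite ler_pM2r //; lra.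
  lra.
have EB : 2 * E < B by rewrite /B; move: E0; lra.
have BE : 0 < B - E by move: EB E0; lra.
pose b := (m * J + N)%N.
have b0 : (0 < b)%N by rewrite /b addn_gt0 N0 orbT.
have b0' : 0 < b%:R :> R by rewrite ltr0n.
(* Decay per step of the mean of [decay], minus the exponent per step paid in Markov's
   inequality. *)
pose gap := (1 - del) / b%:R - L / (B - E).
have gap0 : 0 < gap.
  rewrite subr_gt0 ltr_pdivrMr // mulrAC ltr_pdivlMr // /b natrD mulrDr /B.
  have h1 : L * N%:R + (L' - L) / 2 * N%:R < (1 - del) * (L' * N%:R).
    have : 2 * del * L' * N%:R < (L' - L) * N%:R by rewrite ltr_pM2r.
    lra.
  have h2 : (1 - del) * (2 * E) <= 2 * E.
    by have := mulr_ge0 del0 E0; lra.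
  by have -> : (1 - del) * (L' * N%:R - E - E) = (1 - del) * (L' * N%:R) - (1 - del) * (2 * E);
     [ring | move: E0; lra].
pose sh : G -> R := ind (fun x => len x < L' * N%:R).
have bsh : bounded_fct sh by exact: ind_bounded.
pose cost := step_cost len k E B.
have BEE : B + E = L' * N%:R by rewrite /B; ring.
have xcy : xc <= yc by rewrite /xc /yc -mulrA; move: Y4 eV1 ek; lra.
have xc0 : 0 <= xc by rewrite /xc -mulrA; move: ek0 eV0; lra.
have cost_sh w : cost w <= xc + yc * sh w.
  rewrite /cost /step_cost BEE /sh; case: ifP => h.
    by case: asboolP => _; rewrite ?mulr1 ?mulr0 ?addr0 // lerDl ltW.
  rewrite (_ : `[< _ >] = true) ?mulr1; last by apply/asboolP; rewrite ltNge h.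
  by rewrite lerDr.
have cost_yc w : cost w <= yc by rewrite /cost /step_cost; case: ifP.
pose F := decay len E B.
have bF : bounded_fct F.
  exists 1 => x; rewrite ger0_norm; last exact: expR_ge0.
  by apply: decay_le1.
have F0 x : 0 <= F x by exact: expR_ge0.
pose C1 : R := 2 * e * e * yc.
have C10 : 0 < C1 by apply: mulr_gt0 => //; move: e2; nra.
have tb n f : bounded_fct f -> bounded_fct (iter n T f) by apply: transition_bounded.
have hF r pre z : prefix_avg mul s pre (iter r T F) z <= C1 * \prod_(w <- pre) cost w.
  rewrite -transition_prefix //.
  have bP : bounded_fct (prefix_avg mul s pre F) by exact: prefix_avg_bounded.
  have h y : prefix_avg mul s pre F y <= C1 * \prod_(w <- pre) cost w.
    have := @prefix_word_bound B pre [::] y EB; rewrite {2}/prod_cost big_nil mulr1 /=.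
    move=> h; apply: le_trans h _; rewrite /C1 -[leRHS]mulrA; apply: ler_wpM2l.
      by move: e2; nra.
    rewrite mulrC; apply: ler_wpM2r; last exact: cost_yc.
    exact: prod_cost_ge0.
  have := transition_le mul Ep_lin Ep_ge0 Ep_cst r bP (bounded_fct_cst _ _) h z.
  by rewrite transition_cst.
have Z0 : 0 <= Z by rewrite /Z; move: ek0 eV0; lra.
have Y31 : 1 <= Y3 by rewrite /Y3 /yc; move: e2 Y4; nra.
have sh_eta n : (N <= n)%N -> iter n T sh one <= eta.
  move=> hn; apply: le_trans (hN1 n hn); apply: transition_le => // x.
  rewrite /sh; case: asboolP => h1; case: asboolP => h2 //; exfalso; apply: h2.
  by apply: lt_le_trans h1 _; rewrite ler_pM2l // ler_nat.
have dirtyZ : yc + (1 - alpha) ^+ J * Y3 <= Z * Y3.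
  have : yc + yc <= eV * Y3.
    by have -> : eV * Y3 = eV * e * (2 * yc) by [rewrite /Y3; ring]; rewrite eVe; lra.
  have : 0 <= (e / k%:R) * Y3 by apply: mulr_ge0; exact: ltW.
  by rewrite /Z /yc mulrDl; move: hJ Y4 ek; lra.
have cleanZ : xc + (1 - alpha) ^+ J * Y3 + alpha * yc * (J%:R * eta) <= Z.
  have : alpha * yc * (J%:R * eta) <= 2 * (e / k%:R).
    have -> : 2 * (e / k%:R) = 1 * (yc * (J.+1%:R * eta)).
      by rewrite mul1r [yc * _]mulrA [_ * eta]mulrC /eta divfK // gt_eqF.
    rewrite -[leLHS]mulrA; apply: ler_pM => //; first exact: ltW.
      by apply: mulr_ge0; [exact: ltW | apply: mulr_ge0 => //; exact: ltW].
    by rewrite ler_pM2l // ler_pM2r // ler_nat.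
  by rewrite /xc /Z -[4 * e / _]mulrA; move: hJ; lra.
have alpha01' : 0 <= alpha <= 1 by rewrite (ltW a0).
have cost0 w : 0 <= cost w by apply: step_cost_ge0.
have Zdel : Z <= expR (del - 1).
  rewrite expRD -/(expR (-1)) mulrC.
  have -> : Z = eV * (1 + del).
    rewrite /Z /del mulrDr mulr1; congr (_ + _).
    transitivity (eV * e * (8 * (e / k%:R))); first by rewrite eVe mul1r.
    ring.
  by rewrite ler_pM2l // expR_ge1Dx.
(* The [n %% b] left-over steps are put last, inside the test function. No free steps precede the
   first block, so the lossy bound is used, with an empty prefix. *)
have main n : iter n T F one <= C1 * Y3 * expR (- ((1 - del) * (n %/ b)%:R)).
  rewrite {1}(divn_eq n b) iterD.
  have bh : bounded_fct (iter (n %% b) T F) by exact: tb.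
  have [h _] := block_decay mulA mulg1 Ep_lin Ep_ge0 Ep_cst k0n alpha01' minor cost0 bsh
    (fun w => ler0n _ _) xc0 (ltW yc0) cost_sh cost_yc (ltW C10) Z0 Y31 sh_eta dirtyZ cleanZ
    (n %/ b) bh (hF _).
  apply: le_trans (h [::] one) _; rewrite big_nil mulr1 [leLHS]mulrAC ler_pM2l ?mulr_gt0 //.
  have -> : expR (- ((1 - del) * (n %/ b)%:R)) = expR (del - 1) ^+ (n %/ b).
    by rewrite -expRM_natl; congr expR; ring.
  by apply: lerXn2r => //; rewrite nnegrE // expR_ge0.
(* One constant must serve as prefactor and as inverse rate; the factor e pays for the incomplete
   last block. *)
pose K := C1 * Y3 * e + gap^-1.
have CYe : 0 < C1 * Y3 * e by rewrite !mulr_gt0 // expR_gt0.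
have K0 : 0 < K by rewrite addr_gt0 // invr_gt0.
exists K; split=> // n.
pose Q : G -> R := ind (fun x => len x <= L * n%:R).
have bQ : bounded_fct Q by exact: ind_bounded.
pose M : R := expR (L * n%:R / (B - E)).
have bMF : bounded_fct (fun x => M * F x + 0) by apply: bounded_lin => //; exact: bounded_fct_cst.
have hQ x : Q x <= M * F x + 0.
  rewrite addr0 /Q; case: asboolP => h; last by rewrite mulr_ge0 // expR_ge0.
  rewrite /M /F /decay -expRD -[leLHS]expR0 ler_expR subr_ge0.
  by apply: ler_wpM2r => //; rewrite invr_ge0 ltW.
apply: le_trans (transition_le mul Ep_lin Ep_ge0 Ep_cst n bQ bMF hQ one) _.
rewrite transition_lin //; last exact: bounded_fct_cst.
rewrite transition_cst // addr0.
have M0 : 0 <= M by exact: expR_ge0.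
apply: le_trans (ler_wpM2l M0 (main n)) _.
have -> : M * (C1 * Y3 * expR (- ((1 - del) * (n %/ b)%:R))) =
  C1 * Y3 * expR (L * n%:R / (B - E) - (1 - del) * (n %/ b)%:R).
  by rewrite expRD /M; ring.
have h1 : L * n%:R / (B - E) - (1 - del) * (n %/ b)%:R <= 1 - gap * n%:R.
  apply: exponent_gap => //; last by rewrite del0.
  by rewrite mulSn addnC {1}(divn_eq n b) ltn_add2l ltn_mod.
have h2 : n%:R / K <= gap * n%:R.
  rewrite mulrC; apply: ler_wpM2r => //; rewrite -[leRHS]invrK lef_pV2 ?posrE ?invr_gt0 //.
  by rewrite lerDr ltW.
apply: (@le_trans _ _ (C1 * Y3 * e * expR (- (n%:R / K)))).
  rewrite -[leRHS]mulrA ler_pM2l; last exact: mulr_gt0.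
  by rewrite -expRD ler_expR; lra.
by apply: ler_wpM2r; [exact: expR_ge0 | rewrite lerDl invr_ge0 ltW].
Qed.

End LargeDeviation.

Theorem theorem1p6 (R : realType) (X : Type) (d : X -> X -> R)
  (G : countType) (mul : G -> G -> G) (inv : G -> G) (one : G)
  (act : G -> X -> X) (o : X)
  (dT : measure_display) (T : measurableType dT) (P : probability T R)
  (p : G -> R) (gs : nat -> T -> G) (lam : \bar R) :
  is_metric d -> is_geodesic_space d ->
  isometry_group mul inv one d act ->
  (exists g h : G, contracting_isometry mul inv one d act o g /\
     contracting_isometry mul inv one d act o h /\
     independent mul inv one d act o g h) ->
  is_prob_weights p ->
  (exists g h : G, in_semigroup mul (supp p) g /\ in_semigroup mul (supp p) h /\
     contracting_isometry mul inv one d act o g /\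
     contracting_isometry mul inv one d act o h /\
     independent mul inv one d act o g h) ->
  iid_law P p gs ->
  {ae P, forall w, (fun n : nat => (d o (act (walk mul one gs n w) o) / n%:R)%:E)
                     @ \oo --> lam} ->
  forall L : R, 0 < L -> (L%:E < lam)%E ->
  exists K : R, 0 < K /\ forall n : nat,
    (P [set w | d o (act (walk mul one gs n w) o) <= L * n%:R]%R
       <= (K * expR (- (n%:R / K)))%:E)%E.
Proof.
move=> dm geo ig _ [p0 _] nonel iid hae L L0 Llam.
have [mulA [mul1g [mulg1 _]]] := ig.
(* A finite intermediate speed treats finite and infinite [lam] alike. *)
have [L' [LL' L'lam]] : exists L' : R, L < L' /\ (L'%:E < lam)%E.
  case: lam Llam {hae} => [l| |//]; last by exists (L + 1); split; [lra | exact: ltry].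
  by rewrite lte_fin => h; exists ((L + l) / 2); rewrite lte_fin; split; lra.
have e1 : 1 <= expR 1 :> R by apply: le_trans (expR_ge1Dx _); lra.
have L'L : 0 < L' - L by lra.
have [k hk] := @large_natr R (L' - L) (16 * expR 1 ^+ 2 * L') L'L.
have {}hk := hk k (leqnn k).
have ke : 4 * expR 1 <= k%:R :> R.
  have kL' : (L' - L) * k%:R <= L' * k%:R by apply: ler_wpM2r => //; lra.
  have L'0 : 0 < L' by lra.
  have : 16 * expR 1 ^+ 2 < k%:R :> R by rewrite -(ltr_pM2l L'0); lra.
  by rewrite expr2; nra.
have [m [s [GR [GR2 [GL [E [E0 [hs [badR [badL [GRW [hlen hstep]]]]]]]]]]]] :=
  schottky_family dm ig geo k nonel.
have hpi i : exists a : R, 0 < a /\ forall f, bounded_fct f -> (forall x, 0 <= f x) ->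
    forall x, a * f (mul x (s i)) <= iter m (transition mul (step_mean P gs)) f x.
  have [l [<- [hl ->]]] := hs i; exists (\prod_(h <- l) p h); split.
    by elim: hl => [|h l' hh _ IH]; rewrite ?big_nil // big_cons mulr_gt0.
  by move=> f bf f0 x; apply: (transition_minor_word mulA mulg1 p0 iid).
have [a ha] := choice hpi.
(* A positive lower bound for all [a i] that is also at most 1. *)
pose alpha := \prod_i Num.min (a i) 1.
have min0 i : 0 < Num.min (a i) 1 by rewrite lt_min (ha i).1 ltr01.
have min1 i : 0 <= Num.min (a i) 1 <= 1 by rewrite ltW //= ge_min lexx orbT.
have alpha01 : 0 < alpha <= 1.
  by rewrite prodr_gt0 //=; apply: prodr_ile1 => i _; exact: min1.
have alpha_le i : alpha <= a i.
  rewrite /alpha (bigD1 i) //=; apply: (@le_trans _ _ (Num.min (a i) 1)).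
    by rewrite ler_piMr ?(ltW (min0 i)) //; apply: prodr_ile1 => j _; exact: min1.
  by rewrite ge_min lexx.
have k0 : 0 < k%:R :> R by lra.
have minor f : bounded_fct f -> (forall x, 0 <= f x) -> forall x,
    alpha * avg (fun i => f (mul x (s i))) <= iter m (transition mul (step_mean P gs)) f x.
  move=> bf f0 x; have k0n : (0 < k)%N by rewrite -(ltr0n R).
  rewrite -(avg_cst k0n (iter m _ f x)).
  have -> : alpha * avg (fun i => f (mul x (s i))) = avg (fun i => alpha * f (mul x (s i))).
    by rewrite /avg -mulr_sumr mulrCA.
  apply: avg_le => i; apply: le_trans ((ha i).2 f bf f0 x).
  by apply: ler_wpM2r.
have [K [K0 hK]] := @large_deviation R G mul one mulA mul1g mulg1 (step_mean P gs)
  (step_mean_lin iid) (@step_mean_ge0 R G _ _ P gs) (@step_mean_cst R G _ _ P gs)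
  (len d act o) k m s GR GR2 GL E (len_ge0 act o dm) E0 badR badL GRW hlen hstep ke
  alpha L L' alpha01 minor L0 LL' ltac:(by rewrite [X in _ < X]mulrC)
  (fun eta eta0 => @walk_eventually R G mul one mulA mul1g mulg1 _ _ P p gs p0 iid
     (len d act o) lam L' L'lam hae eta eta0).
exists K; split=> // n.
by rewrite (walk_law mulA mul1g mulg1 p0 iid n [set x | len d act o x <= L * n%:R]) lee_fin.
Qed.
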